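(* Let $n\neq 3$ be a positive integer and $q>1$ a prime power. Up to graph isomorphism, there is a unique directed graph $G$ with no multiple edges that satisfies the following five properties: (i) $V(G)=\bigcup_{k=0}^{n}V_k(G)$, i.e. the number of different outdegrees of vertices of $G$ is $n+1$. (ii) $|V_k(G)|=\binom{n}{k}_q^2$ for all $k\in\{0,1,\ldots,n\}$. (iii) $|N^+(x)\cap V_j(G)|=|N^-(x)\cap V_j(G)|=\binom{n}{j}_q\binom{n-k}{j}_q$ for all $x\in V_k(G)$ and all $j,k\in\{0,1,\ldots,n\}$. (iv) Every target-closed set is the target closure of a single vertex, and every source-closed set is the source closure of a single vertex. (v) $|\mathrm{cl}_t(x)\cap \mathrm{cl}_s(y)\cap V_k(G)|=1$ for all $x,y\in V_k(G)$ and all $k\in\{0,1,\ldots,n\}$. Moreover, this graph $G$ is isomorphic to $\varTheta(M_n(F_q))$.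
   Context: Directed graphs may have loops; ''no multiple edges'' means there is at most one directed edge from $u$ to $v$ for each ordered pair $(u,v)$ of (not necessarily distinct) vertices (so both $u\to v$ and $v\to u$ may be present). For a set $X\subseteq V(G)$ of vertices of a directed graph $G$, $N^+(X)$ is the set of all vertices $w$ such that there is an edge $x\to w$ for every $x\in X$, and $N^-(X)$ is the set of all vertices $w$ such that there is an edge $w\to x$ for every $x\in X$; for a single vertex write $N^\pm(v)=N^\pm(\{v\})$. The target closure and the source closure of $X$ are $\mathrm{cl}_t(X)=N^+(N^-(X))$ and $\mathrm{cl}_s(X)=N^-(N^+(X))$; write $\mathrm{cl}_t(x)=\mathrm{cl}_t(\{x\})$ and $\mathrm{cl}_s(x)=\mathrm{cl}_s(\{x\})$. $X$ is target-closed if $\mathrm{cl}_t(X)=X$ and source-closed if $\mathrm{cl}_s(X)=X$. If $d_0>d_1>d_2>\cdots$ are all the distinct outdegrees of vertices of $G$, then $V_k(G)$ denotes the set of vertices of outdegree $d_k$ (a loop at a vertex contributes one to its outdegree). $F_q$ is the finite field with $q$ elements and $\binom{n}{k}_q$ is the $q$-binomial coefficient, i.e. the number of $k$-dimensional subspaces of $F_q^n$ (equal to $0$ if $k>n$ or $k<0$). For a finite unital ring $R$, define $a\sim b$ if and only if $a=bu=vb$ for some units $u,v\in R$; this is an equivalence relation, and $[a]$ denotes the class of $a$. $\varTheta(R)$ is the directed graph whose vertices are the classes $[a]$, $a\in R$, with a directed edge $[x]\to[y]$ ($[x]$, $[y]$ not necessarily distinct) if and only if $xy=0$ (this is well defined).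 *)

(* Defs.v *)
From HB Require Import structures.
From mathcomp Require Import all_boot all_order all_algebra all_fingroup.

Set Implicit Arguments.
Unset Strict Implicit.
Unset Printing Implicit Defensive.

Import GRing.Theory.
Local Open Scope ring_scope.

(* [edge] need not be irreflexive or symmetric: loops and pairs of opposite
   edges are allowed, and multiple edges are excluded since it is a relation. *)
Record digraph := Digraph {
  vertex :> finType;
  edge : rel vertex
}.

Definition digraph_iso (G H : digraph) : Prop :=
  exists2 f : G -> H, bijective f & {mono f : u v / edge u v}.

Section Digraph.

Variable G : digraph.
Implicit Types (v : G) (X : {set G}) (k : nat).

Definition outnbr X : {set G} := [set w | [forall x in X, edge x w]].
Definition innbr X : {set G} := [set w | [forall x in X, edge w x]].

Definition target_closure X := outnbr (innbr X).
Definition source_closure X := innbr (outnbr X).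

Definition target_closed X := target_closure X = X.
Definition source_closed X := source_closure X = X.

Definition outdegree v := #|[set w | edge v w]|.

(* d_0 > d_1 > ... *)
Definition outdegrees : seq nat := sort geq (undup [seq outdegree v | v : G]).

(* Empty when there are at most [k] distinct outdegrees. *)
Definition level k : {set G} :=
  [set v | (k < size outdegrees)%N && (outdegree v == nth 0%N outdegrees k)].

End Digraph.

(* A k-dimensional subspace of F^n is represented by its set of vectors, and
   given as the row space of a matrix of rank k; matrices with the same row
   space give the same set, so each subspace is counted once. *)
Definition qbinom (F : finFieldType) (n k : nat) : nat :=
  #|[set [set v : 'rV[F]_n | (v <= A)%MS] | A : 'M[F]_n & \rank A == k]|.

Section Properties.

Variables (n : nat) (F : finFieldType) (G : digraph).

Definition levels_cover : Prop :=
  [set: G] = \bigcup_(k < n.+1) level G k /\ size (outdegrees G) = n.+1.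

Definition level_sizes : Prop :=
  forall k, (k <= n)%N -> #|level G k| = (qbinom F n k ^ 2)%N.

Definition neighbour_counts : Prop :=
  forall j k, (j <= n)%N -> (k <= n)%N -> forall x : G, x \in level G k ->
    #|outnbr [set x] :&: level G j| = (qbinom F n j * qbinom F (n - k) j)%N /\
    #|innbr [set x] :&: level G j| = (qbinom F n j * qbinom F (n - k) j)%N.

Definition closed_principal : Prop :=
  (forall X : {set G}, target_closed X ->
     exists x : G, X = target_closure [set x]) /\
  (forall X : {set G}, source_closed X ->
     exists x : G, X = source_closure [set x]).

Definition closures_meet_once : Prop :=
  forall k, (k <= n)%N -> forall x y : G, x \in level G k -> y \in level G k ->
    #|target_closure [set x] :&: source_closure [set y] :&: level G k| = 1%N.

Definition five_properties : Prop :=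
  [/\ levels_cover, level_sizes, neighbour_counts, closed_principal
    & closures_meet_once].

End Properties.

Section Theta.

Variable R : finUnitRingType.
Implicit Types a b u v : R.

Definition assoc a b : bool :=
  [exists u, exists v, [&& u \is a GRing.unit, v \is a GRing.unit,
                           a == b * u & a == v * b]].

Lemma assocP a b :
  reflect (exists u v, [/\ u \is a GRing.unit, v \is a GRing.unit,
                           a = b * u & a = v * b])
          (assoc a b).
Proof.
apply: (iffP existsP) => [[u /existsP[v /and4P[uU vU /eqP au /eqP av]]] | ].
  by exists u, v.
move=> [u [v [uU vU au av]]]; exists u; apply/existsP; exists v.
by rewrite uU vU -au -av eqxx.
Qed.

Lemma assoc_refl : reflexive assoc.
Proof. by move=> a; apply/assocP; exists 1, 1; rewrite unitr1 mulr1 mul1r. Qed.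

Lemma assoc_sym : symmetric assoc.
Proof.
suff H a b : assoc a b -> assoc b a by move=> a b; apply/idP/idP; apply: H.
case/assocP=> u [v [uU vU au av]]; apply/assocP; exists u^-1, v^-1.
by rewrite !unitrV uU vU {1}au av mulrK // mulKr.
Qed.

Lemma assoc_trans : transitive assoc.
Proof.
move=> b a c /assocP[u [v [uU vU au av]]] /assocP[u' [v' [uU' vU' bu bv]]].
apply/assocP; exists (u' * u), (v * v').
by rewrite !unitrMl // mulrA -bu -mulrA -bv.
Qed.

Lemma assoc_equiv : {in [set: R] & &, equivalence_rel assoc}.
Proof.
move=> a b c _ _ _; split=> [|ab]; first exact: assoc_refl.
by apply/idP/idP; apply: assoc_trans => //; rewrite assoc_sym.
Qed.

Definition assoc_classes : {set {set R}} :=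
  equivalence_partition assoc [set: R].

(* The edge relation is independent of representatives: see [Theta_edgeE]. *)
Definition Theta : digraph :=
  @Digraph {A : {set R} | A \in assoc_classes}
    (fun A B => [exists x in val A, exists y in val B, x * y == 0]).

Lemma assoc_class_subproof a : [set b in [set: R] | assoc a b] \in assoc_classes.
Proof. by apply/imsetP; exists a. Qed.

Definition assoc_class a : Theta :=
  exist (fun A => A \in assoc_classes) _ (assoc_class_subproof a).

Lemma assoc_class_eq a b : (assoc_class a == assoc_class b) = assoc a b.
Proof.
apply/eqP/idP => [/(congr1 val)/= /setP/(_ b)|ab].
  by rewrite !inE assoc_refl.
apply: val_inj; apply/setP => c; rewrite !inE /=.
by apply/idP/idP; apply: assoc_trans => //; rewrite assoc_sym.
Qed.

Lemma assoc_class_surj (A : Theta) : exists a, A = assoc_class a.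
Proof. by case: A => A /[dup] /imsetP[a _ ->] Aa; exists a; apply: val_inj. Qed.

Lemma Theta_edgeE a b : edge (assoc_class a) (assoc_class b) = (a * b == 0).
Proof.
apply/existsP/eqP => [[x /andP[]]|ab0].
  rewrite !inE /= => /assocP[_ [v [_ _ _ ->]]] /existsP[y /andP[]].
  rewrite !inE /= => /assocP[u [_ [_ _ -> _]]] /eqP xy0.
  by rewrite -mulrA (mulrA x) xy0 mul0r mulr0.
exists a; rewrite !inE /= assoc_refl /=; apply/existsP; exists b.
by rewrite !inE /= assoc_refl ab0 eqxx.
Qed.

End Theta.

(* Main.v *)
Require Import Defs.
From HB Require Import structures.
From mathcomp Require Import all_boot all_order all_algebra all_fingroup.
From mathcomp Require Import all_solvable all_field zify.

(* The target-closed sets of a graph with the five properties form a lattice, and N^-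
   is an anti-isomorphism of it onto the lattice of source-closed sets.  A vertex x in
   V_k is determined by cl_t(x) and N^+(x), which are closed sets of levels k and n - k,
   every such pair occurs, and x -> y means that cl_t(y) is contained in N^+(x).  So the
   lattice determines the graph.  The neighbour counts say that a closed set of level m
   contains as many closed sets of level j as F_q^m has j-dimensional subspaces, and
   dually; hence closed sets of levels 1, 2, 3 are the points, lines and planes of a
   projective space of order q and dimension n - 1.
   For n >= 4 this space is Desarguesian: a central collineation with axis a hyperplane
   H is built by leaving each plane for a point outside it.  Those with centre in H make
   the points off H an abelian group V, partitioned into the subgroups of translations
   in one direction; those with centre off H show that the ring K of endomorphisms of V
   preserving these subgroups acts transitively on the nonzero elements of each of them.
   K has no zero divisors, so it is a field by Wedderburn, of order q, and V is a vector
   space over it.  For n <= 2 there is nothing to coordinatize.  Finally every closed set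
   gives a subspace of F_q^n, and by counting every subspace arises. *)

Set Implicit Arguments.
Unset Strict Implicit.
Unset Printing Implicit Defensive.

Import GRing.Theory.

(** * Finite fields and finite vector spaces *)

(** The obstacle is Desargues' theorem. For n = 3 the flats only form a projective plane of order q,
    and no point lies outside it. For n >= 4 a count gives a point off both a given plane and H;
    going through such points is what makes the image of a point under a central collineation
    independent of the auxiliary pair that defines it. Before scalars exist there are no dimensions,
    so levels are compared by cardinality: a flat of level k has 1 + q + ... + q^(k-1) points, a
    number that determines k. The levels themselves are recovered from degrees, since the degree
    forced by (iii) strictly decreases with k. The order of K comes from a line: without its point
    in H it has q points, which are the images of one of them under the translations in its
    direction, and K corresponds to these by evaluation. So K has as many elements as F, hence is
    isomorphic to it. Only the graph of the matrix ring is shown directly to have the five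
    properties. Uniqueness compares every graph having them with one model, whose vertices are the
    pairs of subspaces of complementary dimensions. *)

Section FiniteLinearAlgebra.

Local Open Scope ring_scope.

(* Send a generator of E^* to a root in K of its minimal polynomial over F_p. *)
Lemma finField_rmorph_bij (E K : finFieldType) :
  #|E| = #|K| -> exists f : {rmorphism E -> K}, bijective f.
Proof.
move=> eqEK.
have [p p_pr chE] := finPcharP E.
have chK : p \in [pchar K].
  by apply: card_finPcharP p_pr; rewrite -eqEK; apply: (card_pprimeChar chE).
pose L := pPrimeCharType chE; pose M := pPrimeCharType chK.
have /cyclicP[g gE] : cyclic [set: {unit E}] by apply: field_unit_group_cyclic.
pose a : L := val g.
have [m mE] : exists m : {poly 'F_p}, minPoly 1 a = map_poly (in_alg L) m.
  by apply/polyOver1P/minPolyOver.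
have ma0 (f : {poly 'F_p}) : horner_alg a f = 0 -> m %| f.
  move=> fa0; rewrite -(dvdp_map (in_alg L)) -mE; apply: minPoly_dvdp.
    by apply/polyOver1P; exists f.
  by apply/rootP.
(* [m] divides X^#|E| - X, which vanishes at [a]. As #|E| = #|K|, this polynomial is over K the
   product of all X - x, so its nonconstant divisor [m] has a root there. *)
have [b mb0] : exists b : M, horner_alg b m = 0.
  have : map_poly (in_alg M) m %| \prod_(x : K) ('X - x%:P).
    rewrite -finField_genPoly -eqEK.
    have -> : 'X^#|E| - 'X = map_poly (in_alg M) ('X^#|E| - 'X).
      by rewrite rmorphB /= map_polyXn map_polyX.
    rewrite dvdp_map; apply: ma0.
    by rewrite rmorphB rmorphXn /= horner_algX; apply/eqP; rewrite subr_eq0 expf_card.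
  rewrite -big_enum => /dvdp_prod_XsubC[s].
  case es: (mask _ _) => [|x t].
    rewrite big_nil => /eqp_size; rewrite size_poly1 size_map_poly => sm.
    have := size_minPoly 1 a; rewrite mE size_map_poly sm => -[] /esym/eqP.
    by [].
  move/eqp_root=> rt; exists x; apply/rootP.
  by rewrite rt rootE horner_prod big_cons !hornerE subrr mul0r.
have genE (x : L) : {f : {poly 'F_p} | horner_alg a f = x}.
  have [->|x0] := eqVneq x 0; first by exists 0; rewrite rmorph0.
  have /cycleP/sig_eqW[i xE] : finField_unit x0 \in <[g]>%g by rewrite -gE inE.
  exists 'X^i; rewrite rmorphXn /= horner_algX.
  by have /= -> := congr1 val xE; rewrite FinRing.val_unitX.
pose r (x : L) := sval (genE x).
have rE x : horner_alg a (r x) = x by rewrite /r; case: (genE x).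
have rb f h : horner_alg a f = horner_alg a h -> horner_alg b f = horner_alg b h.
  move/eqP; rewrite -subr_eq0 -rmorphB => /eqP/ma0/dvdpP[k fh].
  by apply/eqP; rewrite -subr_eq0 -rmorphB fh rmorphM /= mb0 mulr0.
pose F (x : L) : M := horner_alg b (r x).
have FD : zmod_morphism F.
  by move=> x y; rewrite /F -rmorphB; apply: rb; rewrite rmorphB /= !rE.
have FM : monoid_morphism F.
  split=> [|x y]; first by rewrite -[RHS](rmorph1 (horner_alg b)); apply: rb; rewrite rE rmorph1.
  by rewrite /F -rmorphM; apply: rb; rewrite rmorphM /= !rE.
pose f : {rmorphism E -> K} := HB.pack F (GRing.isZmodMorphism.Build _ _ F FD)
   (GRing.isMonoidMorphism.Build _ _ F FM).
exists f; apply: inj_card_bij; last by rewrite eqEK.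
exact: fmorph_inj.
Qed.

(* Linear combinations of the finitely many elements of V give a linear map from
   'rV_N onto V; it is injective on a complement of its kernel. *)
Lemma fin_lmod_coord (F : finFieldType) (V : lmodType F) (s : seq V) :
  (forall x, x \in s) ->
  exists m (f : {linear 'rV[F]_m -> V}), bijective f.
Proof.
move=> sV; pose N := size s.
pose g (u : 'rV[F]_N) := \sum_i u 0 i *: s`_i.
have gL : linear g.
  move=> a u v; rewrite /g scaler_sumr -big_split; apply: eq_bigr => i _ /=.
  by rewrite !mxE scalerDl scalerA.
pose G : {linear 'rV[F]_N -> V} := HB.pack g (GRing.isLinear.Build F _ _ _ g gL).
have GZ a u : G (a *: u) = a *: G u by rewrite linearZ.
pose K : 'M[F]_(#|{: 'rV[F]_N}|, N) :=
  \matrix_i (if G (enum_val i) == 0 then enum_val i else 0).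
have KP v : (v <= K)%MS = (G v == 0).
  apply/idP/eqP => [/submxP[D ->]|gv0].
    rewrite mulmx_sum_row raddf_sum big1 // => i _.
    apply: (etrans (GZ _ _)); rewrite rowK.
    by case: eqP => [->|_]; last rewrite raddf0; exact: scaler0.
  apply: (submx_trans _ (row_sub (enum_rank v) K)).
  by rewrite rowK enum_rankK gv0 eqxx.
pose B := row_base (K^C)%MS.
exists (\rank (K^C)%MS), (G \o mulmxr B)%FUN.
have inj : injective (G \o mulmxr B).
  apply: raddf_inj => u /= /eqP; rewrite -KP => uK.
  apply/eqP; rewrite -(mulmx_free_eq0 _ (row_base_free (K^C)%MS)) -submx0.
  by rewrite -(capmx_compl K) sub_capmx uK -(eq_row_base (K^C)%MS) submxMl.
have surj x : {y | G (mulmxr B y) == x}.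
  apply: sigW.
  have [u <-] : exists u, G u = x.
    have xs : (index x s < N)%N by rewrite index_mem.
    exists (delta_mx 0 (Ordinal xs)); rewrite /= /g (bigD1 (Ordinal xs)) //= big1 => [|i ni].
      by rewrite mxE !eqxx scale1r addr0 nth_index.
    by rewrite mxE (negbTE ni) scale0r.
  have : (u <= K + K^C)%MS by apply: submx_full; apply: addsmx_compl_full.
  case/sub_addsmxP=> -[u1 u2] /= ->.
  have e0 : G (u1 *m K) = 0 by apply/eqP; rewrite -KP submxMl.
  have : (u2 *m K^C <= B)%MS by rewrite eq_row_base submxMl.
  case/submxP=> D e; exists D; rewrite /= -e; apply/eqP/esym.
  apply: (etrans (raddfD G _ _)); apply: (etrans (congr1 (fun z => z + _) e0)).
  exact: add0r.
exists (fun x => sval (surj x)) => [u|x]; last by case: (surj x) => y /= /eqP.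
by case: (surj _) => y /= /eqP /inj.
Qed.

End FiniteLinearAlgebra.

(** * Subspaces and Gaussian binomials *)

Section Subspaces.

Local Open Scope ring_scope.

Variable F : finFieldType.

Section Dim.

Variable n : nat.
Implicit Types (U W : {set 'rV[F]_n}).

Definition vecs m (A : 'M[F]_(m, n)) : {set 'rV[F]_n} := [set v : 'rV_n | (v <= A)%MS].

Definition Gr k : {set {set 'rV[F]_n}} := [set vecs A | A : 'M[F]_n & \rank A == k].

Lemma vecsS m p (A : 'M[F]_(m, n)) (B : 'M[F]_(p, n)) :
  (vecs A \subset vecs B) = (A <= B)%MS.
Proof.
apply/subsetP/idP => [sAB|sAB v]; last by rewrite !inE => /submx_trans->.
by apply/row_subP=> i; have := sAB (row i A); rewrite !inE row_sub => ->.
Qed.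

Lemma card_vecs m (A : 'M[F]_(m, n)) : #|vecs A| = (#|F| ^ \rank A)%N.
Proof.
have <- : #|{: 'rV[F]_(\rank A)}| = (#|F| ^ \rank A)%N by rewrite card_mx mul1n.
have inj : injective (fun u : 'rV_(\rank A) => u *m row_base A).
  by apply: row_free_inj; apply: row_base_free.
rewrite -(card_imset predT inj); apply: eq_card => v; rewrite !inE -(eq_row_base A).
apply/submxP/imsetP => [[D ->]|[D _ ->]]; by exists D.
Qed.

Lemma vecs_Gr m (A : 'M[F]_(m, n)) : vecs A \in Gr (\rank A).
Proof.
apply/imsetP; exists <<A>>%MS; rewrite ?inE ?genmxE //.
by apply/setP=> v; rewrite !inE genmxE.
Qed.

Lemma GrP k U : reflect (exists2 A : 'M[F]_n, \rank A = k & U = vecs A) (U \in Gr k).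
Proof.
apply: (iffP imsetP) => [[A]|[A rA ->]]; last by exists A; rewrite ?inE ?rA.
by rewrite inE => /eqP rA ->; exists A.
Qed.

Lemma card_Gr k : #|Gr k| = qbinom F n k.
Proof. by []. Qed.

Lemma card_in_Gr k U : U \in Gr k -> #|U| = (#|F| ^ k)%N.
Proof. by case/GrP=> A <- ->; apply: card_vecs. Qed.

Lemma expq_inj i j : (#|F| ^ i == #|F| ^ j)%N = (i == j).
Proof. by apply/eqP/eqP => [/expnI-> //|->//]; apply: finNzRing_gt1. Qed.

Lemma Gr_uniq i j U : U \in Gr i -> U \in Gr j -> i = j.
Proof. by move=> /card_in_Gr Ui /card_in_Gr/eqP; rewrite Ui expq_inj => /eqP. Qed.

Lemma Gr_dim k U : U \in Gr k -> (k <= n)%N.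
Proof. by case/GrP=> A <- _; apply: rank_leq_row. Qed.

(** The dimension is read off the cardinality, so no basis is chosen: the matrix listing all
    elements of [U] as rows has row space [U]. *)
Lemma subspace_Gr k U : 0 \in U -> {in U &, forall u v, u + v \in U} ->
  (forall a, {in U, forall u, a *: u \in U}) -> #|U| = (#|F| ^ k)%N -> U \in Gr k.
Proof.
move=> U0 UD UZ cU.
pose A : 'M[F]_(#|{: 'rV[F]_n}|, n) :=
  \matrix_i (if enum_val i \in U then enum_val i else 0).
have rA i : row i A \in U by rewrite rowK; case: ifP.
suff UA : U = vecs A.
  rewrite UA; have := vecs_Gr A.
  by move: cU; rewrite UA card_vecs => /eqP; rewrite expq_inj => /eqP->.
apply/setP=> v; rewrite inE; apply/idP/idP => [Uv|/submxP[D ->]].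
  apply: (submx_trans _ (row_sub (enum_rank v) A)).
  by rewrite rowK enum_rankK Uv.
rewrite mulmx_sum_row; elim/big_ind: _ => // i _; exact: UZ.
Qed.

Lemma Gr_sub_eq k U W : U \in Gr k -> W \in Gr k -> U \subset W -> U = W.
Proof.
move=> /card_in_Gr cU /card_in_Gr cW sUW; apply/eqP.
by rewrite eqEcard sUW cU cW leqnn.
Qed.

End Dim.

Lemma qbinom_small n k : (n < k)%N -> qbinom F n k = 0%N.
Proof.
move=> lt_nk; apply: eq_card0 => U; apply/negP=> /(@Gr_dim n) le_kn.
by rewrite leqNgt lt_nk in le_kn.
Qed.

Lemma qbinom_gt0 n k : (k <= n)%N -> (0 < qbinom F n k)%N.
Proof.
move=> le_kn; rewrite -card_Gr card_gt0; apply/set0Pn.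
exists (vecs (pid_mx k : 'M[F]_n)).
have rk : \rank (pid_mx k : 'M[F]_n) = k by rewrite rank_pid_mx.
by rewrite -{2}rk; apply: vecs_Gr.
Qed.

Lemma qbinom0 n : qbinom F n 0 = 1%N.
Proof.
rewrite -card_Gr; apply/eqP/cards1P; exists (vecs (0 : 'M[F]_n)).
apply/setP=> U; rewrite inE; apply/GrP/eqP => [[A /eqP]|->].
  by rewrite mxrank_eq0 => /eqP-> ->.
by exists 0; rewrite ?mxrank0.
Qed.

(** The annihilator for the standard bilinear form is injective on subspaces, which gives an
    inequality; applied to k and to n - k it gives equality. *)
Lemma qbinom_sym n k : (k <= n)%N -> qbinom F n (n - k) = qbinom F n k.
Proof.
suff H j : (j <= n)%N -> (qbinom F n j <= qbinom F n (n - j))%N.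
  move=> le_kn; apply/eqP; rewrite eqn_leq H // andbT.
  by have := H (n - k)%N (leq_subr _ _); rewrite subKn.
move=> le_jn.
pose ann (U : {set 'rV[F]_n}) := [set v : 'rV[F]_n | [forall u in U, u *m v^T == 0]].
have annE (A : 'M[F]_n) : ann (vecs A) = vecs (kermx A^T).
  apply/setP=> v; rewrite !inE; apply/forall_inP/sub_kermxP => [vA|vA u].
    apply/rowP=> i; have := vA (row i A); rewrite inE row_sub => /(_ isT)/eqP.
    move/matrixP/(_ 0 0); rewrite !mxE => {2}<-.
    by apply: eq_bigr => l _; rewrite !mxE mulrC.
  rewrite inE => /submxP[D ->]; apply/eqP; rewrite -mulmxA.
  by rewrite -[A]trmxK -trmx_mul vA trmx0 mulmx0.
have kk (A : 'M[F]_n) : (kermx (kermx A^T)^T :=: A)%MS.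
  have sA : (A <= kermx (kermx A^T)^T)%MS.
    by apply/sub_kermxP; apply: trmx_inj; rewrite trmx_mul trmxK mulmx_ker trmx0.
  apply: eqmx_sym; apply/eqmxP; rewrite -(geq_leqif (mxrank_leqif_eq sA)).
  by rewrite !(mxrank_ker, mxrank_tr) subKn ?rank_leq_row.
have annK : {in Gr n j, cancel ann ann}.
  move=> U /GrP[A _ ->]; rewrite !annE; apply/setP=> v.
  by rewrite !inE kk.
rewrite -!card_Gr -(card_in_imset (can_in_inj annK)); apply/subset_leq_card/subsetP.
move=> _ /imsetP[U /GrP[A rA ->] ->]; rewrite annE.
by rewrite -{1}rA -[\rank A]mxrank_tr -mxrank_ker; apply: vecs_Gr.
Qed.

Lemma qbinom_n n : qbinom F n n = 1%N.
Proof. by rewrite -(qbinom_sym (leqnn n)) subnn qbinom0. Qed.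

Lemma card_Gr_sub (n m k : nat) (A : 'M[F]_(m, n)) :
  #|[set U in Gr n k | U \subset vecs A]| = qbinom F (\rank A) k.
Proof.
rewrite -card_Gr.
pose f (W : {set 'rV[F]_(\rank A)}) := [set v *m row_base A | v in W].
have finj : injective f.
  by apply: imset_inj; apply: (row_free_inj (row_base_free A)).
have fE (B : 'M[F]_(\rank A)) : f (vecs B) = vecs (B *m row_base A).
  apply/setP=> v; rewrite inE; apply/imsetP/submxP => [[u]|[D ->]].
    by rewrite inE => /submxP[D ->] ->; exists D; apply/esym/mulmxA.
  by exists (D *m B); rewrite ?mulmxA // inE submxMl.
rewrite -(card_imset _ finj); apply: eq_card => U; rewrite !inE.
apply/andP/imsetP => [[/GrP[B rB ->]]|[_ /GrP[B rB ->] ->]].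
  rewrite vecsS -(eq_row_base A) => /submxP[D BD].
  exists (vecs D); last first.
    apply/setP=> v; rewrite BD; apply/idP/imsetP => [|[u]]; rewrite !inE.
      by case/submxP=> E ->; exists (E *m D); rewrite ?mulmxA // inE submxMl.
    by case/submxP=> E -> ->; rewrite -mulmxA submxMl.
  by rewrite -rB BD mxrankMfree ?row_base_free // vecs_Gr.
rewrite fE; split.
  by rewrite -rB -(mxrankMfree _ (row_base_free A)) vecs_Gr.
by rewrite vecsS -(eq_row_base A) submxMl.
Qed.

(** Each nonzero vector spans one line, and a line has q - 1 nonzero vectors. *)
Lemma qbinom1 (m : nat) : (#|F| ^ m)%N = (1 + #|F|.-1 * qbinom F m 1)%N.
Proof.
have <- : #|{: 'rV[F]_m}| = (#|F| ^ m)%N by rewrite card_mx mul1n.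
rewrite -cardsT (cardsD1 0) inE; congr (_ + _)%N.
have Gv (v : 'rV[F]_m) : v != 0 -> vecs v \in Gr m 1.
  by move=> v0; have := vecs_Gr v; rewrite rank_rV v0.
rewrite -sum1_card (partition_big (fun v => vecs v) (mem (Gr m 1))) /=; last first.
  by move=> v; rewrite !inE andbT => /Gv.
rewrite (eq_bigr (fun _ => #|F|.-1)); first by rewrite sum_nat_const mulnC card_Gr.
move=> U GU; rewrite sum1_card.
transitivity #|U :\ 0|.
  apply: eq_card => v; rewrite unfold_in /= !in_setD1 in_setT andbT.
  have [//|v0 /=] := eqVneq v 0.
  apply/eqP/idP => [<-|Uv]; first by rewrite inE.
  apply: (@Gr_sub_eq _ 1) => //; first exact: Gv.
  by case/GrP: GU Uv => A _ ->; rewrite vecsS inE.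
have : 0 \in U by case/GrP: GU => A _ ->; rewrite inE sub0mx.
by move=> U0; have := cardsD1 0 U; rewrite U0 (card_in_Gr GU) expn1 => ->.
Qed.

Lemma qbinom1_recl (m : nat) : qbinom F m.+1 1 = (#|F| * qbinom F m 1 + 1)%N.
Proof.
have q1 : (1 < #|F|)%N by apply: finNzRing_gt1.
have := qbinom1 m.+1; rewrite expnS qbinom1.
move: (qbinom F m.+1 1) (qbinom F m 1) => x y; case: #|F| q1 => [|[|q]] //= _.
by nia.
Qed.

(** Later on, this is how the number of points of a flat determines its level. *)
Lemma qbinom1_mono (i j : nat) : (qbinom F i 1 <= qbinom F j 1)%N = (i <= j)%N.
Proof.
have q1 : (1 < #|F|)%N by apply: finNzRing_gt1.
by rewrite -(leq_exp2l i j q1) !qbinom1 leq_add2l leq_pmul2l // -subn1 subn_gt0.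
Qed.

End Subspaces.

(** * Translations of an affine space *)

Section AffineSpace.

Variables (A D : finType) (dir : A -> A -> D).

(** For distinct points, [dir x y] stands for the parallel class of the line xy. The hypotheses
    below express collinearity and parallelism through it alone. *)
Definition dilatation (s : A -> A) := forall x y, x != y -> dir (s x) (s y) = dir x y.

Definition on_line m x c := (m == x) || (dir x m == c).

Hypothesis dirC : forall x y, x != y -> dir x y = dir y x.
Hypothesis dir_line : forall x y z, x != y -> x != z -> y != z ->
  dir x y = dir x z -> dir y z = dir x y.
Hypothesis dir_meet : forall x y x' y', x != y -> x' != y' -> dir x y = dir x' y' ->
  x != x' -> y != y' -> dir x x' != dir y y' ->
  exists m, on_line m x (dir x x') && on_line m y (dir y y').
Hypothesis ex_translation : forall x y, x != y -> exists s, [/\ injective s,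
  dilatation s, s x = y & forall z, s z != z -> dir z (s z) = dir x y].
Hypothesis ex_homothety : forall o x y, o != x -> o != y -> dir o x = dir o y ->
  exists s, [/\ injective s, dilatation s, s o = o & s x = y].
Hypothesis ex_off_line : forall x c, exists2 z, z != x & dir x z != c.

Implicit Types (s t g : {perm A}) (c d : D).

(** The direction is an argument, so that the identity counts as a translation in every direction
    and the translations in one direction are closed under products. *)
Definition translation s c :=
  [forall x, forall y, (x != y) ==> (dir (s x) (s y) == dir x y)] &&
  [forall x, (s x != x) ==> (dir x (s x) == c)].

Lemma translationP s c : reflect (dilatation s /\ forall x, s x != x -> dir x (s x) = c)
  (translation s c).
Proof.
apply: (iffP andP) => -[].
  move=> /'forall_forallP h1 /'forall_implyP h2; split.
    by move=> x y; move/implyP: (h1 x y) => h /h/eqP.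
  by move=> x /h2/eqP.
move=> h1 h2; split; last by apply/'forall_implyP => x /h2/eqP.
by apply/'forall_forallP => x y; apply/implyP => /h1/eqP.
Qed.

Lemma dil1 : dilatation (1%g : {perm A}).
Proof. by move=> x y _; rewrite !perm1. Qed.

Lemma dilM s t : dilatation s -> dilatation t -> dilatation (s * t)%g.
Proof. by move=> hs ht x y xy; rewrite !permM ht ?hs // (inj_eq perm_inj). Qed.

Lemma dilV s : dilatation s -> dilatation (s^-1)%g.
Proof.
move=> hs x y xy; rewrite -[in RHS](permKV s x) -[in RHS](permKV s y) hs //.
by rewrite (inj_eq perm_inj).
Qed.

Lemma translation1 c : translation 1 c.
Proof. by apply/translationP; split; [exact: dil1|move=> x; rewrite perm1 eqxx]. Qed.

Lemma translation_uniq s c d : translation s c -> translation s d -> c != d -> s = 1%g.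
Proof.
move=> /translationP[_ hc] /translationP[_ hd] cd; apply/permP=> x; rewrite perm1.
by apply/eqP; apply: contraNT cd => nx; rewrite -(hc x nx) -(hd x nx).
Qed.

Lemma translationV s c : translation s c -> translation s^-1 c.
Proof.
case/translationP=> hs sc; apply/translationP; split; first exact: dilV.
move=> x nx; have y_eq : s (s^-1 x)%g = x by rewrite permKV.
by rewrite dirC 1?eq_sym // -[X in dir _ X]y_eq sc // y_eq eq_sym.
Qed.

Lemma translationJ s g c : dilatation g -> translation s c -> translation (s ^ g) c.
Proof.
move=> hg /translationP[hs sc]; apply/translationP; split.
  by rewrite /conjg; apply: dilM (dilV hg) (dilM hs hg).
move=> x; rewrite -(permKV g x) permJ (inj_eq perm_inj) => nx.
by rewrite hg ?sc // eq_sym.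
Qed.

(* A moved point u lies on the lines of direction c through every fixed point. *)
Lemma translation_fix s c x : translation s c -> s x = x -> s = 1%g.
Proof.
case/translationP=> hs sc.
have key y u : s y = y -> s u != u -> u != y /\ dir y u = c.
  move=> sy su; have uy : u != y by apply: contraNneq su => ->; rewrite sy.
  split=> //; have ysu : y != s u by rewrite -sy (inj_eq perm_inj) eq_sym.
  have yu : y != u by rewrite eq_sym.
  have e : dir y u = dir y (s u) by rewrite -{2}sy hs.
  by rewrite -(sc u su) (dir_line yu ysu _ e) // eq_sym.
move=> sx; apply/permP=> u; rewrite perm1; apply/eqP/negPn/negP=> su.
have [ux xu] := key x u sx su; have [z zx xz] := ex_off_line x c.
have sz : s z = z.
  by apply/eqP/negPn/negP => nz; have [_ e] := key x z sx nz; rewrite e eqxx in xz.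
have [uz zu] := key z u sz su.
have zu' : dir u z = c by rewrite dirC.
have xu' : dir u x = c by rewrite dirC // -xu.
have nxz : x != z by rewrite eq_sym.
by case/eqP: xz; rewrite (dir_line ux uz nxz) xu'.
Qed.

Lemma translationM1 s t c : translation s c -> translation t c -> translation (s * t) c.
Proof.
move=> /translationP[hs sc] /translationP[ht tc]; apply/translationP; split; first exact: dilM.
move=> x; rewrite permM => nx.
have [e|n1] := eqVneq (s x) x; first by rewrite e in nx *; apply: tc.
have [e|n2] := eqVneq (t (s x)) (s x); first by rewrite e sc.
have n1' : x != s x by rewrite eq_sym.
have nx' : x != t (s x) by rewrite eq_sym.
have n2' : s x != t (s x) by rewrite eq_sym.
have e : dir (s x) x = dir (s x) (t (s x)) by rewrite dirC // sc // tc.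
by rewrite (dir_line n1 n2' nx' e) dirC // sc.
Qed.

Variable O : A.

(** The line joining x to g x has the same direction as the one joining u to g u for every point u
    on it. Two such lines with different directions would meet, by [dir_meet], in a point with both
    directions. *)
Lemma dilatation_nofix g : dilatation g -> (forall x, g x != x) ->
  translation g (dir O (g O)).
Proof.
move=> hg nf.
have key x u : on_line u x (dir x (g x)) -> dir u (g u) = dir x (g x).
  case/predU1P=> [->//|/eqP e].
  have [->//|ux] := eqVneq u x; have xu : x != u by rewrite eq_sym.
  have gxu : g x != g u by rewrite (inj_eq perm_inj).
  have gn z : z != g z by rewrite eq_sym.
  have egxu := hg x u xu.
  have [e1|n1] := eqVneq (g x) u; first by rewrite -{1}e1 egxu.
  have n2 : u != g x by rewrite eq_sym.
  have e2 : dir (g x) u = dir x u.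
    rewrite (dirC n1) (dir_line xu (gn x) n2 e) //.
  by rewrite (dir_line n1 gxu (gn u)) ?e2 ?egxu ?e.
apply/translationP; split=> // x _.
have [->//|xO] := eqVneq x O; have Ox : O != x by rewrite eq_sym.
apply/esym/eqP/negPn/negP => ne.
have gOx : g O != g x by rewrite (inj_eq perm_inj).
have nf' z : z != g z by rewrite eq_sym.
have [m /andP[m1 m2]] := dir_meet Ox gOx (esym (hg O x Ox)) (nf' O) (nf' x) ne.
by case/eqP: ne; rewrite -(key O m m1) -(key x m m2).
Qed.

Definition translations := [set s : {perm A} | [exists c, translation s c]].

Lemma translationsP s : reflect (exists c, translation s c) (s \in translations).
Proof. by rewrite inE; apply: existsP. Qed.

Lemma translations_fix s x : s \in translations -> s x = x -> s = 1%g.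
Proof. by case/translationsP=> c; apply: translation_fix. Qed.

Lemma translations_group_set : group_set translations.
Proof.
apply/group_setP; split.
  by apply/translationsP; exists (dir O O); apply: translation1.
move=> s t /translationsP[c sc] /translationsP[d td]; apply/translationsP.
have [cd|cd] := eqVneq c d; first by rewrite -cd in td; exists c; apply: translationM1.
have [hs sc'] := translationP _ _ sc; have [ht td'] := translationP _ _ td.
have [x /eqP fx|nf] := pickP (fun x => (s * t)%g x == x); last first.
  by exists (dir O ((s * t)%g O)); apply: dilatation_nofix; [apply: dilM|move=> x; rewrite nf].
(* The product fixes [x]. If [s] fixes it too, both factors are the identity; otherwise [t] brings
   [s x] back along the same line, against c != d. *)
rewrite permM in fx; have [sx|sx] := eqVneq (s x) x.
  rewrite (translation_fix sc sx) (@translation_fix t d x) ?mul1g //.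
    by exists c; apply: translation1.
  by rewrite -{1}sx.
have tx : t (s x) != s x by rewrite fx eq_sym.
by case/eqP: cd; rewrite -(sc' x sx) -(td' (s x) tx) fx dirC // eq_sym.
Qed.

Canonical translations_group := Group translations_group_set.
Local Notation T := translations.

Lemma translations_dil s : s \in T -> dilatation s.
Proof. by case/translationsP=> c /translationP[]. Qed.

Lemma translations_trans x y : exists2 s, s \in T & s x = y.
Proof.
have [->|xy] := eqVneq x y; first by exists 1%g; rewrite ?group1 ?perm1.
have [f [finj fd fx fz]] := ex_translation xy.
exists (perm finj); last by rewrite permE.
apply/translationsP; exists (dir x y); apply/translationP; split.
  by move=> u v uv; rewrite !permE fd.
by move=> u; rewrite permE => /fz.
Qed.

Lemma translations_inj x s t : s \in T -> t \in T -> s x = t x -> s = t.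
Proof.
move=> sT tT e; apply/eqP; rewrite eq_mulgV1; apply/eqP.
by apply: (@translations_fix _ x); rewrite ?groupM ?groupV // permM e permK.
Qed.

(** The commutator is s^-1 times a conjugate of s, a translation in direction c, and also a
    conjugate of t^-1 times t, a translation in direction d; so it is the identity. *)
Lemma translations_commute_neq s t c d : translation s c -> translation t d -> c != d ->
  commute s t.
Proof.
move=> sc td cd; apply/commgP/eqP.
have [hs _] := translationP _ _ sc; have [ht _] := translationP _ _ td.
apply: (@translation_uniq _ c d) => //.
  by apply: translationM1 (translationV sc) _; apply: translationJ.
rewrite /commg /conjg !mulgA; apply: translationM1 => //.
rewrite -{2}[s]invgK -mulgA.
have := translationJ hs (translationV td); rewrite /conjg.
by rewrite invgK mulgA.
Qed.

(* Translations in the same direction commute because both commute with t * r and r,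
   for r a translation in another direction. *)
Lemma translations_abelian : abelian T.
Proof.
apply/centsP=> s sT t tT; case/translationsP: (sT) => c sc; case/translationsP: (tT) => d td.
have [cd|cd] := eqVneq c d; last exact: translations_commute_neq sc td cd.
rewrite -{}cd in td; have [z zO Oz] := ex_off_line O c.
have [r rT rO] := translations_trans O z.
have nr : ~~ translation r c.
  by apply: contra Oz => /translationP[_ /(_ O)]; rewrite rO => ->.
have cr g : g \in T -> ~~ translation g c -> commute s g.
  case/translationsP=> e ge gc; apply: (translations_commute_neq sc ge).
  by apply: contraNneq gc => ->.
have -> : t = ((t * r) * r^-1)%g by rewrite mulgK.
apply: commuteM; last by apply: commuteV; apply: cr.
apply: cr; first exact: groupM.
apply: contra nr => trc; rewrite -[r](mulKg t).
by apply: translationM1 trc; apply: translationV.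
Qed.

(** The translations act sharply transitively, so exactly one takes [O] to [x] and the default value
    never occurs. Points are added by composing these translations. *)
Definition tau x := odflt 1%g [pick s in T | s O == x].

Lemma tauP x : tau x \in T /\ tau x O = x.
Proof.
rewrite /tau; case: pickP => [s /andP[sT /eqP]//|no].
by have [s sT sO] := translations_trans O x; have := no s; rewrite /= sT sO eqxx.
Qed.

Lemma tauT x : tau x \in T. Proof. by case: (tauP x). Qed.
Lemma tauO x : tau x O = x. Proof. by case: (tauP x). Qed.

Lemma tau_eq s : s \in T -> tau (s O) = s.
Proof. by move=> sT; apply: (@translations_inj O); rewrite ?tauT ?tauO. Qed.

Definition vadd x y := tau x y.

Lemma tau_add x y : tau (vadd x y) = (tau x * tau y)%g.
Proof.
rewrite (centsP translations_abelian) ?tauT // -[RHS]tau_eq ?groupM ?tauT //.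
by rewrite permM tauO.
Qed.

Lemma vaddA : associative vadd.
Proof.
move=> x y z; rewrite /vadd -/(vadd x y) tau_add (centsP translations_abelian) ?tauT //.
by rewrite permM.
Qed.

Lemma vaddC : commutative vadd.
Proof.
move=> x y; have e (z t : A) : vadd z t = (tau t * tau z)%g O by rewrite permM tauO.
by rewrite !e (centsP translations_abelian) ?tauT.
Qed.

Lemma vadd0 : left_id O vadd.
Proof.
move=> x; have tO : tau O = 1%g.
  by apply: (@translations_inj O); rewrite ?tauT ?group1 // tauO perm1.
by rewrite /vadd tO perm1.
Qed.

Definition vopp x := (tau x)^-1%g O.

Lemma vaddN : left_inverse O vopp vadd.
Proof. by move=> x; rewrite vaddC /vadd /vopp permKV. Qed.

(** Subtracting u is a translation, hence keeps directions. A homothety g with centre [O] conjugates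
    [tau u] to a translation taking [O] to g u, that is, to [tau (g u)]; so g is additive. *)
Theorem affine_zmodule : exists (V : finZmodType) (f : V -> A),
  [/\ bijective f,
      forall u v, u != v -> dir (f u) (f v) = dir (f 0%R) (f (v - u)%R)
    & forall x y, x != 0%R -> y != 0%R -> dir (f 0%R) (f x) = dir (f 0%R) (f y) ->
      exists g : V -> V, [/\ {morph g : u v / (u + v)%R}, g x = y &
        forall z, z != 0%R -> g z != 0%R -> dir (f 0%R) (f (g z)) = dir (f 0%R) (f z)]].
Proof.
pose V : finZmodType := HB.pack A (GRing.isZmodule.Build A vaddA vaddC vadd0 vaddN).
exists V, id; split; first by exists id.
  move=> u v uv /=; have hN : dilatation (tau (- u : V)%R) by apply: translations_dil (tauT _).
  rewrite -(hN u v uv) -[in LHS]/(vadd (- u : V)%R u) -[in LHS]/(vadd (- u : V)%R v).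
  by rewrite vaddN [(v - u)%R]addrC.
move=> x y x0 y0 e; have Ox : O != x by rewrite eq_sym.
have Oy : O != y by rewrite eq_sym.
have [g [ginj gd gO gx]] := ex_homothety Ox Oy e.
exists g; split=> // [u v|z z0 _]; last first.
  by have Oz : O != z; [rewrite eq_sym|have := gd O z Oz; rewrite gO].
pose h := perm ginj; have hE z : g z = h z by rewrite permE.
have hd : dilatation h by move=> a b; rewrite -!hE; apply: gd.
have hT : (tau u ^ h)%g \in T.
  by case/translationsP: (tauT u) => c tc; apply/translationsP; exists c; apply: translationJ.
have hO : h O = O by rewrite -hE.
have eO : (tau u ^ h)%g O = g u by rewrite -[in LHS]hO permJ tauO hE.
have -> : ((g u : V) + (g v : V))%R = tau (g u) (h v) by rewrite -hE.
by rewrite -eO tau_eq // permJ -hE.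
Qed.

End AffineSpace.

(** * The kernel of a spread of subgroups *)

Section Kernel.

Local Open Scope ring_scope.

Variables (V : finZmodType) (D : eqType) (d : V -> D).

Hypothesis dB : forall x y, x != 0 -> y != 0 -> x != y -> d x = d y -> d (x - y) = d x.
Hypothesis dN : forall x, x != 0 -> d (- x) = d x.
Hypothesis d_trans : forall x y, x != 0 -> y != 0 -> d x = d y ->
  exists g : V -> V, [/\ {morph g : u v / u + v}, g x = y &
    forall z, z != 0 -> g z != 0 -> d (g z) = d z].
Hypothesis d_two : forall c, exists2 y, y != 0 & d y != c.

(* The sets [same_block z] are the translation groups in one direction; they are
   subgroups covering V. *)
Definition same_block z w := (w == 0) || ((z != 0) && (d w == d z)).

Lemma same_blockB z x y : same_block z x -> same_block z y -> same_block z (x - y).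
Proof.
rewrite /same_block.
have [->|x0] /= := eqVneq x 0; have [->|y0] /= := eqVneq y 0; rewrite ?subrr ?eqxx //.
- by rewrite sub0r oppr_eq0 (negbTE y0) dN.
- by rewrite subr0 (negbTE x0).
case/andP=> -> /eqP dx /andP[_ /eqP dy] /=.
have [->|xy] := eqVneq x y; rewrite ?subrr ?eqxx //.
by rewrite dB ?dx ?eqxx ?orbT // dy.
Qed.

(** Finite functions make the endomorphism ring a finite type, as Wedderburn's theorem requires. *)
Definition block_endo : {pred {ffun V -> V}} := [pred f : {ffun V -> V} |
  [forall x, forall y, f (x + y) == f x + f y] && [forall z, same_block z (f z)]].

Lemma block_endoP (f : {ffun V -> V}) :
  reflect ({morph f : x y / x + y} /\ forall z, same_block z (f z)) (f \in block_endo).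
Proof.
apply: (iffP andP) => -[h1 h2]; split.
- by move=> x y; apply/eqP; move/'forall_forallP: h1; apply.
- by apply/forallP.
- by apply/'forall_forallP => x y; rewrite h1.
by apply/forallP.
Qed.

Lemma block_endo_zmod : zmod_closed block_endo.
Proof.
split=> [|f g /block_endoP[fD fb] /block_endoP[gD gb]]; apply/block_endoP.
  by split=> [x y|z]; rewrite !ffunE ?addr0 // /same_block eqxx.
split=> [x y|z]; rewrite !ffunE; first by rewrite fD gD opprD addrACA.
exact: same_blockB.
Qed.

HB.instance Definition _ := GRing.isZmodClosed.Build {ffun V -> V} block_endo block_endo_zmod.

Record kernel := Kernel { kernel_fun :> {ffun V -> V}; _ : kernel_fun \in block_endo }.

HB.instance Definition _ := [isSub for kernel_fun].
HB.instance Definition _ := [Finite of kernel by <:].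
HB.instance Definition _ := [SubChoice_isSubZmodule of kernel by <:].

Lemma kerD (f : kernel) : {morph f : x y / x + y}.
Proof. by case/block_endoP: (valP f). Qed.

Lemma ker_block (f : kernel) z : same_block z (f z).
Proof. by case/block_endoP: (valP f). Qed.

Lemma ker_d (f : kernel) z : f z != 0 -> z != 0 /\ d (f z) = d z.
Proof.
have := ker_block f z; rewrite /same_block.
by case/predU1P=> [->|/andP[-> /eqP]]; rewrite ?eqxx.
Qed.

Lemma kerP (f g : kernel) : (forall x, f x = g x) -> f = g.
Proof. by move=> fg; apply/val_inj/ffunP. Qed.

Lemma kernel_mul_subproof (f g : kernel) : [ffun x => f (g x)] \in block_endo.
Proof.
apply/block_endoP; split=> [x y|z]; rewrite !ffunE; first by rewrite !kerD.
rewrite /same_block; have [->//|/ker_d[g0 ->]] := eqVneq (f (g z)) 0.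
by have [-> ->] := ker_d g0; rewrite eqxx.
Qed.

Lemma kernel_one_subproof : [ffun x => x] \in block_endo.
Proof.
apply/block_endoP; split=> [x y|z]; rewrite !ffunE // /same_block eqxx andbT.
by case: eqP.
Qed.

Definition kernel_mul f g := Kernel (kernel_mul_subproof f g).
Definition kernel_one := Kernel kernel_one_subproof.

Lemma kernel_mulA : associative kernel_mul.
Proof. by move=> f g h; apply: kerP => x; rewrite !ffunE. Qed.
Lemma kernel_mul1 : left_id kernel_one kernel_mul.
Proof. by move=> f; apply: kerP => x; rewrite !ffunE. Qed.
Lemma kernel_1mul : right_id kernel_one kernel_mul.
Proof. by move=> f; apply: kerP => x; rewrite !ffunE. Qed.
Lemma kernel_mulDl : left_distributive kernel_mul +%R.
Proof. by move=> f g h; apply: kerP => x; rewrite !ffunE. Qed.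
Lemma kernel_mulDr : right_distributive kernel_mul +%R.
Proof. by move=> f g h; apply: kerP => x; rewrite !ffunE kerD. Qed.

Variable x0 : V.
Hypothesis x0_neq0 : x0 != 0.

Lemma kernel_one_neq0 : kernel_one != 0.
Proof.
apply: contraNneq x0_neq0 => /(congr1 (fun f : kernel => f x0)).
by rewrite /= !ffunE => ->.
Qed.

HB.instance Definition _ := GRing.Zmodule_isNzRing.Build kernel
  kernel_mulA kernel_mul1 kernel_1mul kernel_mulDl kernel_mulDr kernel_one_neq0.
HB.instance Definition _ := FinRing.isNzRing.Build kernel.

(* If f x = 0 and v is in another block, then f v = f (x + v) lies in the blocks of
   both v and x + v, which are distinct; so f vanishes outside the block of x, and
   then everywhere. *)
Lemma ker_inj (f : kernel) x : x != 0 -> f x = 0 -> f = 0.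
Proof.
have key u v : u != 0 -> f u = 0 -> d v != d u -> f v = 0.
  move=> u0 fu dvu; apply/eqP/negPn/negP => fv0.
  have [v0 fv] := ker_d fv0.
  have fuv : f (u + v) = f v by rewrite kerD fu add0r.
  have [uv0] : u + v != 0 /\ d (f (u + v)) = d (u + v) by apply: ker_d; rewrite fuv.
  rewrite fuv fv => e; case/eqP: dvu.
  have nuv : u + v != v by rewrite -subr_eq0 addrK.
  by have := dB uv0 v0 nuv (esym e); rewrite addrK -e.
move=> nx fx; apply: kerP => y; rewrite [RHS]ffunE.
have [yx|yx] := eqVneq (d y) (d x); last exact: key yx.
have [z z0 zx] := d_two (d x).
have fz := key x z nx fx zx; apply: (key z) => //.
by rewrite yx eq_sym.
Qed.

Lemma kernel_domain : GRing.integral_domain_axiom kernel.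
Proof.
move=> f g fg; have [//|f0 /=] := eqVneq f 0.
apply/eqP/(ker_inj x0_neq0)/eqP; apply: contraNT f0 => gx0; apply/eqP.
apply: (ker_inj gx0).
by have := congr1 (fun h : kernel => h x0) fg; rewrite /= !ffunE.
Qed.

(** Commutativity is Wedderburn's little theorem, contained in [FinDomainFieldType]. *)
Definition kernel_field := FinDomainFieldType kernel_domain.

Lemma ker_trans x y : x != 0 -> y != 0 -> d x = d y -> exists f : kernel, f x = y.
Proof.
move=> nx ny e; have [g [gD gx gd]] := d_trans nx ny e.
have gb : [ffun z => g z] \in block_endo.
  apply/block_endoP; split=> [u v|z]; rewrite !ffunE // /same_block.
  have [//|gz /=] := eqVneq (g z) 0.
  have [z0|z0 /=] := eqVneq z 0; last by rewrite gd.
  by case/eqP: gz; rewrite z0; apply: (addIr (g 0)); rewrite -gD !add0r.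
by exists (Kernel gb); rewrite /= ffunE.
Qed.

(** Evaluation at [x0] is injective by [ker_inj] and reaches the whole block of [x0] by
    [ker_trans]. *)
Lemma card_kernel : #|{: kernel}| = #|[set x | (x == 0) || (d x == d x0)]|.
Proof.
have inj : injective (fun f : kernel => f x0).
  move=> f g /eqP fg; apply/eqP; rewrite -subr_eq0; apply/eqP/(ker_inj x0_neq0).
  by rewrite /= !ffunE; apply/eqP; rewrite subr_eq0.
rewrite -(card_imset predT inj); apply: eq_card => x; rewrite !inE.
apply/imsetP/idP => [[f _ ->]|].
  by have := ker_block f x0; rewrite /same_block x0_neq0.
have [-> _|nx /= /eqP dx] := eqVneq x 0; first by exists 0; rewrite //= ffunE.
by have [f <-] := ker_trans x0_neq0 nx (esym dx); exists f.
Qed.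

Variable F : finFieldType.
Hypothesis card_block : #|[set x | (x == 0) || (d x == d x0)]| = #|F|.

(** Scalars from the kernel preserve each block and act transitively on its nonzero elements, so
    over F the blocks are exactly the one-dimensional subspaces. *)
Theorem block_coordinates : exists m (f : 'rV[F]_m -> V),
  [/\ bijective f, {morph f : u v / u + v} &
    forall u v, u != 0 -> v != 0 -> d (f u) = d (f v) <-> exists a, v = a *: u].
Proof.
have [r rbij] : exists r : {rmorphism F -> kernel_field}, bijective r.
  by apply: finField_rmorph_bij; rewrite -card_block -card_kernel.
pose scale a (v : V) := (r a : kernel) v.
have sA a b v : scale a (scale b v) = scale (a * b) v.
  by rewrite /scale rmorphM /= ffunE.
have s1 : left_id 1 scale by move=> v; rewrite /scale rmorph1 /= ffunE.
have sDr : right_distributive scale +%R by move=> a u v; rewrite /scale kerD.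
have sDl v : {morph scale^~ v : a b / a + b}.
  by move=> a b; rewrite /scale rmorphD /= ffunE.
pose W : lmodType F := HB.pack V (GRing.Zmodule_isLmodule.Build F V sA s1 sDr sDl).
have [m [f fbij]] : exists m (f : {linear 'rV[F]_m -> W}), bijective f.
  by apply: (@fin_lmod_coord F W (enum V)) => x; rewrite mem_enum.
have f0 u : u != 0 -> f u != 0 :> V.
  by move=> u0; apply: contraNneq u0 => fu; apply/eqP/(bij_inj fbij); rewrite fu raddf0.
exists m, f; split=> //; first by move=> u v; apply: raddfD.
have fZ a u : f (a *: u) = scale a (f u) by rewrite linearZ.
move=> u v u0 v0; split=> [duv|[a av]]; last first.
  by move: (f0 v v0); rewrite av fZ => /ker_d[_ ->].
have [g gu] := ker_trans (f0 u u0) (f0 v v0) duv.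
have [r' rK r'K] := rbij; exists (r' g); apply: (bij_inj fbij).
by rewrite fZ /scale r'K gu.
Qed.

End Kernel.

(** * Coordinates of a projective space *)

Section ProjectiveSpace.

Variables (P : finType) (line plane : {set {set P}}) (H : {set P}).

Hypothesis line_ex : forall x y : P, exists2 l, l \in line & x \in l /\ y \in l.
Hypothesis line_uniq : forall l m x y, l \in line -> m \in line -> x != y ->
  x \in l -> y \in l -> x \in m -> y \in m -> l = m.
Hypothesis plane_ex : forall x y z : P,
  exists2 p, p \in plane & [/\ x \in p, y \in p & z \in p].
Hypothesis plane_line : forall p l x y, p \in plane -> l \in line -> x != y ->
  x \in l -> y \in l -> x \in p -> y \in p -> l \subset p.
Hypothesis plane_uniq : forall p r l z, p \in plane -> r \in plane -> l \in line ->
  z \notin l -> l \subset p -> l \subset r -> z \in p -> z \in r -> p = r.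
Hypothesis plane_meet : forall p l m, p \in plane -> l \in line -> m \in line ->
  l \subset p -> m \subset p -> exists2 x, x \in l & x \in m.
Hypothesis H_line : forall l x y, l \in line -> x != y ->
  x \in l -> y \in l -> x \in H -> y \in H -> l \subset H.
Hypothesis H_meet : forall l, l \in line -> exists2 x, x \in l & x \in H.
Hypothesis off_plane : forall p, p \in plane ->
  exists2 x, x \notin p & x \notin H.

Definition ln x y := odflt set0 [pick l in line | (x \in l) && (y \in l)].

Lemma lnP x y : [/\ ln x y \in line, x \in ln x y & y \in ln x y].
Proof.
rewrite /ln; case: pickP => [l /= /and3P[] //|no].
by have [l ll [xl yl]] := line_ex x y; have := no l; rewrite ll xl yl.
Qed.

Lemma ln_line x y : ln x y \in line. Proof. by case: (lnP x y). Qed.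
Lemma lnl x y : x \in ln x y. Proof. by case: (lnP x y). Qed.
Lemma lnr x y : y \in ln x y. Proof. by case: (lnP x y). Qed.

Lemma lnE l x y : l \in line -> x != y -> x \in l -> y \in l -> ln x y = l.
Proof.
by move=> ll nxy xl yl; apply: (line_uniq _ ll nxy) => //; rewrite (ln_line, lnl, lnr).
Qed.

Lemma lnC x y : ln x y = ln y x.
Proof. by rewrite /ln; congr odflt; apply: eq_pick => l /=; rewrite [(x \in l) && _]andbC. Qed.

Lemma ln_eq x y z : x != z -> z \in ln x y -> ln x z = ln x y.
Proof. by move=> nxz zl; apply: lnE => //; rewrite (ln_line, lnl). Qed.

Lemma ln_swap x y z : x != z -> z \in ln x y -> y \in ln x z.
Proof. by move=> nxz /ln_eq-> //; apply: lnr. Qed.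

Lemma ln_plane p x y : p \in plane -> x != y -> x \in p -> y \in p -> ln x y \subset p.
Proof. by move=> pp nxy; apply: plane_line nxy _ _; rewrite ?(ln_line, lnl, lnr). Qed.

Lemma ln_H x y : x != y -> x \in H -> y \in H -> ln x y \subset H.
Proof. by move=> nxy; apply: H_line nxy _ _; rewrite ?(ln_line, lnl, lnr). Qed.

Lemma ln_H_uniq x y e f : x \notin H -> e \in ln x y -> f \in ln x y ->
  e \in H -> f \in H -> e = f.
Proof.
move=> xH el fl eH fH; apply/eqP; apply: contraNT xH => nef.
by apply: (subsetP (H_line (ln_line x y) nef el fl eH fH)); apply: lnl.
Qed.

Lemma memH_neq x e : x \notin H -> e \in H -> x != e.
Proof. by move=> xH eH; apply: contraNneq xH => ->. Qed.

(** * Central collineations with axis H *)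

Section Central.

Variable C : P.

(* [U'] is a candidate for the image of [U] under a central collineation with centre
   [C] and axis [H]; two compatible pairs can belong to the same collineation. *)
Definition central_pair (U U' : P) :=
  [/\ U \notin H, U' \notin H, C != U, C != U' & U' \in ln C U].

Definition compatible (U U' Y Y' : P) :=
  [/\ central_pair U U', central_pair Y Y', Y \notin ln C U &
      exists2 e, e \in H & e \in ln U Y /\ e \in ln U' Y'].

Lemma central_pair_sym U U' : central_pair U U' -> central_pair U' U.
Proof. by case=> ? ? ? ? /ln_swap; split=> //; auto. Qed.

Lemma central_pair_ln U U' : central_pair U U' -> ln C U' = ln C U.
Proof. by case=> ? ? ? ? /ln_eq; auto. Qed.

Lemma compatible_sym U U' Y Y' : compatible U U' Y Y' -> compatible Y Y' U U'.
Proof.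
case=> QU QY nY [e eH [e1 e2]]; split=> //; last first.
  by exists e => //; rewrite lnC e1 lnC.
by apply: contra nY => /ln_swap-> //; case: QU.
Qed.

Lemma compatible_swap U U' Y Y' : compatible U U' Y Y' -> compatible U' U Y' Y.
Proof.
case=> QU QY nY [e eH [e1 e2]].
split; [exact: central_pair_sym|exact: central_pair_sym| |by exists e].
rewrite (central_pair_ln QU); apply: contra nY => Y'U.
by rewrite -(ln_eq _ Y'U) ?(central_pair_ln QY) ?lnr //; case: QY.
Qed.

(** With e the point of UY in [H], the image of Y must be the intersection of CY and U'e; these
    lines meet because both lie in the plane CUY. *)
Lemma compatible_ex U U' Y : central_pair U U' -> Y \notin H -> Y \notin ln C U ->
  exists Y', compatible U U' Y Y'.
Proof.
move=> QU YH YCU; have [UH U'H CU CU' U'l] := QU.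
have UY : U != Y by apply: contraNneq YCU => <-; apply: lnr.
have CY : C != Y by apply: contraNneq YCU => <-; apply: lnl.
have UCY : U \notin ln C Y by apply: contra YCU => /ln_swap->.
have U'CY : U' \notin ln C Y.
  by apply: contra YCU => /ln_swap; rewrite (central_pair_ln QU) => ->.
have [p pp [Cp Up Yp]] := plane_ex C U Y.
have [e el eH] := H_meet (ln_line U Y).
have ep : e \in p by apply: (subsetP (ln_plane pp UY Up Yp)).
have U'p : U' \in p by apply: (subsetP (ln_plane pp CU Cp Up)).
have U'e := memH_neq U'H eH; have Ue := memH_neq UH eH.
have [Y' Y'1 Y'2] := plane_meet pp (ln_line C Y) (ln_line U' e)
  (ln_plane pp CY Cp Yp) (ln_plane pp U'e U'p ep).
have U'Y' : U' != Y' by apply: contraNneq U'CY => ->.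
exists Y'; split=> //; last by exists e => //; rewrite el; split=> //; apply: ln_swap.
split=> //.
  apply/negP=> Y'H; have Y'e : Y' = e by apply: (ln_H_uniq U'H Y'2 _ Y'H eH); apply: lnr.
  subst Y'; case/negP: UCY.
  have Ye := memH_neq YH eH.
  rewrite lnC in Y'1; rewrite lnC in el.
  by rewrite lnC -(ln_eq Ye Y'1) (ln_eq Ye el) lnr.
apply: contraNneq YCU => CY'; rewrite -CY' in Y'2.
have eCU : e \in ln U C.
  by rewrite lnC -(central_pair_ln QU) lnC; apply: ln_swap; rewrite // eq_sym.
by rewrite lnC -(ln_eq Ue eCU); apply: ln_swap.
Qed.

Lemma compatible_uniq U U' Y Y1 Y2 : compatible U U' Y Y1 -> compatible U U' Y Y2 -> Y1 = Y2.
Proof.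
case=> QU [YH Y1H CY CY1 Y1l] nY [e eH [e1 e2]] [_ [_ Y2H _ CY2 Y2l] _ [f fH [f1 f2]]].
have [UH U'H CU CU' U'l] := QU.
have ef : e = f by apply: ln_H_uniq e1 f1 eH fH.
subst f; have U'e := memH_neq U'H eH.
apply/eqP; apply: contraNT nY => n12.
have Y1e := ln_swap U'e e2; have Y2e := ln_swap U'e f2.
have ll : ln C Y = ln U' e by apply: (line_uniq _ _ n12); rewrite ?ln_line.
by rewrite -(central_pair_ln QU); apply: ln_swap; rewrite // ll lnl.
Qed.

(* The plane U'Y'Z' meets H in the same line as UYZ, since both contain the points
   of UY and UZ in H. *)
Lemma compatible_trans_noncoplanar U U' Y Y' Z Z' : compatible U U' Y Y' -> compatible U U' Z Z' ->
  (forall p, p \in plane -> C \in p -> U \in p -> Y \in p -> Z \notin p) ->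
  compatible Y Y' Z Z'.
Proof.
case=> QU QY nY [e1 e1H [e1Y e1Y']] [_ QZ nZ [e2 e2H [e2Z e2Z']]] ncop.
have [UH U'H CU CU' U'l] := QU.
have [YH Y'H CY CY' Y'l] := QY; have [ZH Z'H CZ CZ' Z'l] := QZ.
have UY : U != Y by apply: contraNneq nY => <-; apply: lnr.
have UZ : U != Z by apply: contraNneq nZ => <-; apply: lnr.
have ZCY : Z \notin ln C Y.
  have [p pp [Cp Up Yp]] := plane_ex C U Y.
  by apply: contra (ncop p pp Cp Up Yp); apply/subsetP/ln_plane.
have YZ : Y != Z by apply: contraNneq ZCY => ->; apply: lnr.
have Y'Z' : Y' != Z'.
  apply: contraNneq ZCY => YZ'; rewrite -(central_pair_ln QY) YZ' (central_pair_ln QZ); exact: lnr.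
split=> //; have [e el eH] := H_meet (ln_line Y Z).
exists e => //; split=> //.
have e12 : e1 != e2.
  have [p pp [Cp Up Yp]] := plane_ex C U Y.
  apply: contraNneq (ncop p pp Cp Up Yp) => e12; rewrite -e12 in e2Z.
  apply: (subsetP (ln_plane pp UY Up Yp)).
  have Ue1 := memH_neq UH e1H.
  by rewrite -(ln_eq Ue1 e1Y); apply: ln_swap.
have e_e12 : e \in ln e1 e2.
  have [p pp [Up Yp Zp]] := plane_ex U Y Z.
  have e1p : e1 \in p by apply: (subsetP (ln_plane pp UY Up Yp)).
  have e2p : e2 \in p by apply: (subsetP (ln_plane pp UZ Up Zp)).
  have [m m1 m2] := plane_meet pp (ln_line Y Z) (ln_line e1 e2)
    (ln_plane pp YZ Yp Zp) (ln_plane pp e12 e1p e2p).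
  have mH : m \in H by apply: (subsetP (ln_H e12 e1H e2H)).
  by rewrite (ln_H_uniq YH el m1 eH mH).
have U'Y' : U' != Y'.
  by apply: contraNneq nY => U'Y'; rewrite -(central_pair_ln QU) U'Y' (central_pair_ln QY) lnr.
have U'Z' : U' != Z'.
  by apply: contraNneq nZ => U'Z'; rewrite -(central_pair_ln QU) U'Z' (central_pair_ln QZ) lnr.
have [p pp [U'p Y'p Z'p]] := plane_ex U' Y' Z'.
have e1p : e1 \in p by apply: (subsetP (ln_plane pp U'Y' U'p Y'p)).
have e2p : e2 \in p by apply: (subsetP (ln_plane pp U'Z' U'p Z'p)).
have ep : e \in p by apply: (subsetP (ln_plane pp e12 e1p e2p)).
have [r rr [Cr Yr Zr]] := plane_ex C Y Z.
have Y'r : Y' \in r by apply: (subsetP (ln_plane rr CY Cr Yr)).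
have Z'r : Z' \in r by apply: (subsetP (ln_plane rr CZ Cr Zr)).
have er : e \in r by apply: (subsetP (ln_plane rr YZ Yr Zr)).
(* If [e] were off the line Y'Z', the planes U'Y'Z' and CYZ would both be spanned by this line and
   [e]. Then CYZ would contain U', hence U. *)
apply/negPn/negP=> ne.
have pr : p = r.
  by apply: (plane_uniq pp rr (ln_line Y' Z') ne) => //; apply: ln_plane.
have Ur : U \in r.
  apply: (subsetP (ln_plane rr CU' Cr _)); first by rewrite -pr.
  by rewrite (central_pair_ln QU) lnr.
by have := ncop r rr Cr Ur Yr; rewrite Zr.
Qed.

(* In the coplanar case go through a point V outside the plane. *)
Lemma compatible_trans W W' U U' Y Y' : compatible W W' U U' -> compatible W W' Y Y' ->
  Y \notin ln C U -> compatible U U' Y Y'.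
Proof.
move=> RU RY nY; have [QW [UH U'H CU CU' U'l] nU _] := RU.
have [_ [YH Y'H CY CY' Y'l] nYW _] := RY; have [WH W'H CW CW' W'l] := QW.
have [p pp [Cp Wp Up]] := plane_ex C W U.
have WU : W != U by apply: contraNneq nU => <-; apply: lnr.
have lWU q : q \in plane -> C \in q -> W \in q -> U \in q -> q = p.
  move=> qq Cq Wq Uq; apply: (plane_uniq qq pp (ln_line C W) nU) => //; exact: ln_plane.
have [Yp|Yp] := boolP (Y \in p); last first.
  by apply: compatible_trans_noncoplanar RU RY _ => q qq Cq Wq Uq; rewrite (lWU q).
have [V Vp VH] := off_plane pp.
have VW : V \notin ln C W by apply: contra Vp; apply/subsetP/ln_plane.
have [V' RV] := compatible_ex QW VH VW.
have VCU q : q \in plane -> C \in q -> W \in q -> V \in q -> U \notin q.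
  by move=> qq Cq Wq Vq; apply: contra Vp => Uq; rewrite -(lWU q).
have RVU := compatible_trans_noncoplanar RV RU VCU.
apply: (compatible_trans_noncoplanar RVU).
  apply: (compatible_trans_noncoplanar RV RY) => q qq Cq Wq Vq.
  apply: contra Vp => Yq.
  by rewrite -(plane_uniq qq pp (ln_line C W) nYW) //; apply: ln_plane.
move=> q qq Cq Vq Uq; apply: contra Vp => Yq.
by rewrite -(plane_uniq qq pp (ln_line C U) nY) //; apply: ln_plane.
Qed.

End Central.

(** The centre may lie on the axis or off it. Off the axis it belongs to the affine part and has to
    be fixed, whence the last clause; the two cases become translations and homotheties. *)
Theorem central_collineation C W W' : central_pair C W W' ->
  exists s : P -> P,
  [/\ s W = W',
      forall Y, Y \notin H -> s Y \notin H,
      {in [pred Y | Y \notin H] &, injective s},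
      forall Y Z, Y \notin H -> Z \notin H -> Y != Z ->
        exists2 e, e \in H & e \in ln Y Z /\ e \in ln (s Y) (s Z)
    & forall Y, Y \notin H -> s Y \in ln C Y /\ (C == Y -> s Y = Y)].
Proof.
move=> QW; have [WH W'H CW CW' W'l] := QW.
(* The pair of [W] says nothing directly about points of the line CW. For these the image is found
   from any pair compatible with that of [W], so compatibility with all such pairs is required. *)
pose good Y Y' := [/\ central_pair C Y Y', (Y \notin ln C W -> compatible C W W' Y Y') &
  forall U U', compatible C W W' U U' -> Y \notin ln C U -> compatible C U U' Y Y'].
have aux Y : Y \notin H -> C != Y -> exists U U', compatible C W W' U U' /\ Y \notin ln C U.
  move=> YH CY; have [p pp [Cp Wp Yp]] := plane_ex C W Y.
  have [U Up UH] := off_plane pp.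
  have UW : U \notin ln C W by apply: contra Up; apply/subsetP/ln_plane.
  have [U' RU] := compatible_ex QW UH UW.
  exists U, U'; split=> //; apply: contra Up => YU.
  by apply: (subsetP (ln_plane pp CY Cp Yp)); apply: ln_swap.
have goodP Y : Y \notin H -> C != Y -> exists Y', good Y Y'.
  move=> YH CY; have [YCW|YCW] := boolP (Y \in ln C W); last first.
    have [Y' RY] := compatible_ex QW YH YCW; exists Y'; split=> //; first by case: RY.
    by move=> U U' RU nY; apply: compatible_trans RU RY nY.
  have [U [U' [RU nY]]] := aux Y YH CY.
  have [_ QU nU _] := RU.
  have [Y' RY] := compatible_ex QU YH nY; have [_ QY _ _] := RY.
  have lYW : ln C Y = ln C W by apply: ln_eq.
  have step V V' T T' : compatible C W W' V V' -> compatible C V V' Y Y' ->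
    compatible C W W' T T' ->
    T \notin ln C V -> compatible C T T' Y Y'.
    move=> RV RVY RT nT; have RVT := compatible_trans RV RT nT.
    by apply: (compatible_trans RVT RVY); have [_ [_ _ CT _ _] nTW _] := RT;
      apply: contra nTW; rewrite -lYW; apply: ln_swap.
  exists Y'; split=> //; first by rewrite YCW.
  move=> T T' RT nT.
  (* When [T] is on CU the two pairs cannot be compared directly; a point [V] off the plane CWU
     links them. *)
  have [TU|TU] := boolP (T \in ln C U); last exact: step RU RY RT TU.
  have [p pp [Cp Wp Up]] := plane_ex C W U.
  have [V Vp VH] := off_plane pp.
  have nV X : C != X -> X \in p -> V \notin ln C X.
    by move=> CX Xp; apply: contra Vp; apply/subsetP/ln_plane.
  have [_ [TH T'H CT CT' T'l] _ _] := RT.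
  have [_ _ CU _ _] := QU.
  have [V' RV] := compatible_ex QW VH (nV W CW Wp).
  have [_ [_ _ CV _ _] _ _] := RV.
  have RVY := step _ _ _ _ RU RY RV (nV U CU Up).
  apply: step RV RVY RT _.
  have Tp : T \in p by apply: (subsetP (ln_plane pp CU Cp Up)).
  by apply: contra (nV T CT Tp) => /ln_swap; apply.
have /fin_all_exists[s sP] Y : exists Y', if (Y \notin H) && (C != Y) then good Y Y'
    else Y' = Y.
  have [/andP[YH CY]|_] := boolP ((Y \notin H) && (C != Y)); last by exists Y.
  exact: goodP.
have sg Y : Y \notin H -> C != Y -> good Y (s Y).
  by move=> YH CY; have := sP Y; rewrite YH CY.
have sC : s C = C by have := sP C; rewrite eqxx andbF.
have sQ Y : Y \notin H -> C != Y -> central_pair C Y (s Y) by move=> YH CY; case: (sg Y YH CY).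
have sR Y Z : Y \notin H -> C != Y -> Z \notin H -> C != Z -> Z \notin ln C Y ->
    compatible C Y (s Y) Z (s Z).
  move=> YH CY ZH CZ nZ; have [_ Y1 Y2] := sg Y YH CY; have [_ Z1 Z2] := sg Z ZH CZ.
  have nY : Y \notin ln C Z by apply: contra nZ => /ln_swap; apply.
  have [YW|YW] := boolP (Y \in ln C W).
    apply: compatible_sym; apply: Y2 => //; apply: Z1.
    by apply: contra nZ => ZW; rewrite (ln_eq CY YW).
  by apply: Z2 => //; apply: Y1.
have sne Y Z : Y \notin H -> C != Y -> Z \notin H -> C != Z -> Z != Y -> s Y != s Z.
  move=> YH CY ZH CZ ZY; have QY := sQ Y YH CY; have QZ := sQ Z ZH CZ.
  have [ZCY|ZCY] := boolP (Z \in ln C Y); last first.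
    by apply: contraNneq ZCY => e; rewrite -(central_pair_ln QY) e (central_pair_ln QZ) lnr.
  (* For two points on one line through [C], take a pair compatible with both: after exchanging
     source and image, [compatible_uniq] recovers each point from its image. *)
  have [U [U' [RU nY]]] : exists U U', compatible C U U' Y (s Y) /\ compatible C U U' Z (s Z).
    have lYZ := ln_eq CZ ZCY; have [_ Y1 Y2] := sg Y YH CY; have [_ Z1 Z2] := sg Z ZH CZ.
    have [YW|YW] := boolP (Y \in ln C W); last first.
      exists W, W'; split; [exact: Y1|apply: Z1].
      by apply: contra YW => ZW; rewrite -(ln_eq CZ ZW) lYZ lnr.
    have [U [U' [RU nY]]] := aux Y YH CY.
    have [_ [_ _ CU _ _] _ _] := RU.
    exists U, U'; split; [exact: Y2|apply: Z2 => //].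
    by apply: contra nY => ZU; rewrite -(ln_eq CZ ZU) lYZ lnr.
  apply: contraNneq ZY => e; apply/eqP.
  by move/compatible_swap: RU; move/compatible_swap: nY; rewrite e; apply: compatible_uniq.
have sC' Z : Z \notin H -> C != Z -> C != s Z by move=> ZH /(sQ Z ZH)[].
exists s; split.
- have [U [U' [RU nW]]] := aux W WH CW.
  have [_ _ W2] := sg W WH CW; exact: compatible_uniq (W2 _ _ RU nW) (compatible_sym RU).
- move=> Y YH; have [CY|CY] := eqVneq C Y; last by have [] := sQ Y YH CY.
  by rewrite -CY sC CY.
- move=> Y Z /= YH ZH e; apply/eqP; rewrite !inE in YH ZH.
  have [CY|CY] := eqVneq C Y; have [CZ|CZ] := eqVneq C Z.
  + by rewrite -CY -CZ.
  + by have := sC' Z ZH CZ; rewrite -e -CY sC eqxx.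
  + by have := sC' Y YH CY; rewrite e -CZ sC eqxx.
  by apply/negPn/negP; rewrite eq_sym => /(sne Y Z YH CY ZH CZ); rewrite e eqxx.
- move=> Y Z YH ZH YZ.
  wlog CY : Y Z YH ZH YZ / C != Y.
    move=> hw; have [CY|CY] := eqVneq C Y; last exact: hw.
    have ZY : Z != Y by rewrite eq_sym.
    have CZ : C != Z by rewrite CY.
    have [e eH [e1 e2]] := hw Z Y ZH YH ZY CZ.
    by exists e => //; rewrite lnC e1 lnC.
  have QY := sQ Y YH CY; have [_ _ _ CsY sYl] := QY.
  have [CZ|CZ] := eqVneq C Z.
    have [e el eH] := H_meet (ln_line C Y).
    by exists e => //; rewrite -CZ sC -!(lnC C) (central_pair_ln QY).
  have [ZCY|ZCY] := boolP (Z \in ln C Y); last by have [] := sR Y Z YH CY ZH CZ ZCY.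
  have [_ _ _ CsZ sZl] := sQ Z ZH CZ.
  have [e el eH] := H_meet (ln_line C Y); exists e => //.
  have sYZ : s Y != s Z by apply: sne; rewrite // eq_sym.
  rewrite (ln_eq CZ ZCY) in sZl.
  by rewrite !(@lnE (ln C Y)) ?ln_line ?lnr.
move=> Y YH; have [<-|CY] := eqVneq C Y; first by rewrite sC lnl.
by have [] := sQ Y YH CY.
Qed.

(** * The affine space of the points off H, and its coordinates *)

Local Notation A := {x : P | x \notin H}.
Implicit Types (x y z : A).

(** The point at infinity of the line xy represents its parallel class; a line with a point off [H]
    has exactly one. *)
Definition dir x y : P := odflt (val x) [pick e in H | e \in ln (val x) (val y)].

Lemma dirP x y : dir x y \in H /\ dir x y \in ln (val x) (val y).
Proof.
rewrite /dir; case: pickP => [e /andP[]//|no].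
by have [e el eH] := H_meet (ln_line (val x) (val y)); have := no e; rewrite /= eH el.
Qed.

Lemma dirH x y : dir x y \in H. Proof. by case: (dirP x y). Qed.
Lemma dir_ln x y : dir x y \in ln (val x) (val y). Proof. by case: (dirP x y). Qed.

Lemma dir_eq x y e : e \in H -> e \in ln (val x) (val y) -> dir x y = e.
Proof. by move=> eH el; apply: (ln_H_uniq (valP x) (dir_ln x y) el (dirH x y) eH). Qed.

Lemma neq_dir x y z : val x != dir y z.
Proof. by apply: memH_neq (valP x) (dirH y z). Qed.

Lemma ln_dir x y : ln (val x) (dir x y) = ln (val x) (val y).
Proof. by apply: ln_eq; [apply: neq_dir|apply: dir_ln]. Qed.

Lemma dirC x y : x != y -> dir x y = dir y x.
Proof. by move=> _; apply: dir_eq; [apply: dirH|rewrite lnC dir_ln]. Qed.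

Lemma dir_line x y z : x != y -> x != z -> y != z -> dir x y = dir x z ->
  dir y z = dir x y.
Proof.
move=> xy xz yz e; apply: dir_eq; first exact: dirH.
have el : ln (val x) (val y) = ln (val x) (val z) by rewrite -ln_dir e ln_dir.
by rewrite (@lnE (ln (val x) (val y))) ?ln_line ?lnr ?dir_ln // el lnr.
Qed.

(** The lines xy and x'y' share a point at infinity, so the four points lie in one plane. There xx'
    and yy' meet, and a meeting point in [H] would make their directions equal. *)
Lemma dir_meet x y x' y' : x != y -> x' != y' -> dir x y = dir x' y' ->
  x != x' -> y != y' -> dir x x' != dir y y' ->
  exists m, on_line dir m x (dir x x') && on_line dir m y (dir y y').
Proof.
move=> xy xy' e xx yy ne.
have [p pp [px px' pe]] := plane_ex (val x) (val x') (dir x y).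
have py : val y \in p.
  by apply: (subsetP (ln_plane pp (neq_dir x x y) px pe)); rewrite ln_dir lnr.
have py' : val y' \in p.
  rewrite e in pe.
  by apply: (subsetP (ln_plane pp (neq_dir x' x' y') px' pe)); rewrite ln_dir lnr.
have [m m1 m2] := plane_meet pp (ln_line _ _) (ln_line _ _)
  (ln_plane pp xx px px') (ln_plane pp yy py py').
have mH : m \notin H.
  by apply: contra ne => mH; rewrite (dir_eq mH m1) (dir_eq mH m2).
have on (a b : A) : m \in ln (val a) (val b) -> on_line dir (Sub m mH) a (dir a b).
  move=> mab; rewrite /on_line; have [//|nma] := eqVneq (Sub m mH) a.
  have am : val a != m by rewrite eq_sym.
  by apply/eqP/dir_eq; rewrite ?dirH //= (ln_eq am mab) dir_ln.
by exists (Sub m mH); rewrite !on.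
Qed.

Lemma dilatation_of_central C x y : central_pair C (val x) (val y) -> exists s : A -> A,
  [/\ injective s, dilatation dir s, s x = y &
   forall z, val (s z) \in ln C (val z) /\ (C == val z -> s z = z)].
Proof.
move=> Cxy; have [s [sx sH sinj sdir sC]] := central_collineation Cxy.
exists (fun z => Sub (s (val z)) (sH _ (valP z))); split.
- by move=> a b /(congr1 val)/= /sinj => e; apply/val_inj/e; apply: valP.
- move=> a b ab; have [e eH [e1 e2]] := sdir (val a) (val b) (valP a) (valP b) ab.
  by rewrite (dir_eq eH e1); apply: dir_eq.
- exact: val_inj.
by move=> z; have [zl zC] := sC (val z) (valP z); split=> // Cz; apply/val_inj/zC.
Qed.

(** The centre is the point at infinity of xy; moved points then move along lines through it. *)
Lemma ex_translation x y : x != y -> exists s, [/\ injective s,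
  dilatation dir s, s x = y & forall z, s z != z -> dir z (s z) = dir x y].
Proof.
move=> xy; have [|s [sinj sd sx sC]] := @dilatation_of_central (dir x y) x y.
  have nd z : dir x y != val z by rewrite eq_sym neq_dir.
  by split; rewrite ?nd ?(valP x) ?(valP y) // lnC ln_dir lnr.
exists s; split=> // z szz; apply: dir_eq; first exact: dirH.
have [zl _] := sC z; have zsz : val z != val (s z) by rewrite eq_sym.
by rewrite lnC in zl; rewrite (ln_eq zsz zl) lnr.
Qed.

Lemma ex_homothety o x y : o != x -> o != y -> dir o x = dir o y ->
  exists s, [/\ injective s, dilatation dir s, s o = o & s x = y].
Proof.
move=> ox oy e; have [|s [sinj sd sx sC]] := @dilatation_of_central (val o) x y.
  by split; rewrite ?(valP x) ?(valP y) // -ln_dir e ln_dir lnr.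
by exists s; split=> //; have [_ ->] := sC o.
Qed.

Lemma ex_off_line x c : exists2 z, z != x & dir x z != c.
Proof.
have [p pp [px pc _]] := plane_ex (val x) c c.
have [z zp zH] := off_plane pp; exists (Sub z zH).
  by apply: contraNneq zp => zx; rewrite -zx in px.
apply: contra zp => /eqP zc; rewrite -zc in pc.
by apply: (subsetP (ln_plane pp (neq_dir _ _ _) px pc)); rewrite ln_dir lnr.
Qed.

Variables (F : finFieldType) (O : P).
Hypothesis O_notin_H : O \notin H.
Hypothesis card_line : forall l, l \in line -> #|l| = #|F|.+1.

Local Open Scope ring_scope.

Lemma affine_coordinates : exists m (f : 'rV[F]_m -> A),
  [/\ bijective f, forall u v, u != v -> dir (f u) (f v) = dir (f 0) (f (v - u)) &
   forall u v, u != 0 -> v != 0 -> dir (f 0) (f u) = dir (f 0) (f v) <-> exists a, v = a *: u].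
Proof.
have [V [g [gbij gB ghom]]] := affine_zmodule dirC dir_line dir_meet ex_translation
  ex_homothety ex_off_line (Sub O O_notin_H).
have [g' gK g'K] := gbij; have ginj := bij_inj gbij.
pose d v := dir (g 0) (g v).
have gn (x y : V) : x != y -> g x != g y by rewrite (inj_eq ginj).
have dB (x y : V) : x != 0 -> y != 0 -> x != y -> d x = d y -> d (x - y) = d x.
  move=> nx ny xy e; have yx : y != x by rewrite eq_sym.
  have zx : 0 != x by rewrite eq_sym.
  have zy : 0 != y by rewrite eq_sym.
  by rewrite /d -gB // (dir_line (gn _ _ zy) (gn _ _ zx) (gn _ _ yx)).
have dN (x : V) : x != 0 -> d (- x) = d x.
  by move=> nx; rewrite /d -sub0r -gB // dirC // gn.
have d_two c : exists2 y, y != 0 & d y != c.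
  have [z zx zc] := ex_off_line (g 0) c; exists (g' z); last by rewrite /d g'K.
  by rewrite -(inj_eq ginj) g'K.
have [x0 nx0 _] := d_two O.
(* Together with its point at infinity, the block of [x0] is the line through [g 0] and [g x0],
   which has q + 1 points. *)
have cb : #|[set x : V | (x == 0) || (d x == d x0)]| = #|F|.
  apply: succn_inj; rewrite -(card_line (ln_line (val (g 0)) (val (g x0)))).
  rewrite (cardsD1 (d x0)) dir_ln; congr _.+1.
  rewrite -(card_imset _ (inj_comp val_inj ginj)); apply: eq_card => z.
  rewrite !inE; apply/imsetP/andP => [[x + ->]|[zd zl]]; rewrite /= ?inE.
    case/predU1P=> [->|/eqP dx]; first by rewrite lnl neq_dir.
    by rewrite neq_dir -ln_dir -/(d x0) -dx ln_dir lnr.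
  have zH : z \notin H.
    by apply: contra zd => zH; rewrite /d (dir_eq zH zl).
  exists (g' (Sub z zH)); last by rewrite /= g'K.
  rewrite inE -(inj_eq ginj) g'K; have [//|zg /=] := eqVneq _ (g 0).
  rewrite /d g'K; apply/eqP/dir_eq; first exact: dirH.
  by rewrite /= (@ln_eq _ (val (g x0))) ?dir_ln //= eq_sym.
have [m [h [hbij hD hprop]]] := block_coordinates dB dN ghom d_two nx0 cb.
have h0 : h 0 = 0 by apply: (addIr (h 0)); rewrite -hD !add0r.
have hN u : h (- u) = - h u by apply: (addIr (h u)); rewrite -hD !addNr.
have hinj := bij_inj hbij.
exists m, (g \o h); split=> [|u v uv|u v u0 v0 /=]; first exact: bij_comp.
  by rewrite /= gB ?(inj_eq hinj) // h0 hD hN.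
by rewrite h0; apply: hprop.
Qed.

(* The affine point with vector u has homogeneous coordinates (u, 1), and the point at
   infinity in the direction of u has coordinates (u, 0). *)
Theorem projective_coordinates : exists m (psi : 'rV[F]_(m + 1) -> P),
  [/\ forall u v, u != 0 -> v != 0 -> psi u = psi v <-> exists a, v = a *: u,
      forall x : P, exists2 u, u != 0 & psi u = x
    & forall S : {set P}, {in S &, forall x y : P, x != y -> ln x y \subset S} ->
      forall u v, u != 0 -> v != 0 -> u + v != 0 ->
        psi u \in S -> psi v \in S -> psi (u + v) \in S].
Proof.
have [m [f [fbij fB fP]]] := affine_coordinates; have finj := bij_inj fbij.
have fn p r : p != r -> f p != f r by rewrite (inj_eq finj).
have fZ c w : c != 0 -> w != 0 -> dir (f 0) (f (c *: w)) = dir (f 0) (f w).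
  move=> c0 w0; apply/esym/fP => //; first by rewrite scaler_eq0 negb_or c0.
  by exists c.
pose L (w : 'rV[F]_(m + 1)) : 'rV[F]_m := lsubmx w.
pose h (w : 'rV[F]_(m + 1)) : F := rsubmx w 0 0.
have LhP u v : L u = L v -> h u = h v -> u = v.
  move=> eL eh; rewrite -(hsubmxK u) -(hsubmxK v) -/(L u) eL; congr row_mx.
  by apply/rowP=> i; rewrite ord1; apply: eh.
have LZ a u : L (a *: u) = a *: L u by rewrite /L linearZ.
have hZ a u : h (a *: u) = a * h u by rewrite /h !mxE.
have LD u v : L (u + v) = L u + L v by rewrite /L linearD.
have hD u v : h (u + v) = h u + h v by rewrite /h !mxE.
have L_neq0 u : u != 0 -> h u = 0 -> L u != 0.
  move=> u0 hu; apply: contraNneq u0 => Lu; apply/eqP/LhP; rewrite ?Lu ?hu.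
    by rewrite /L linear0.
  by rewrite /h !mxE.
pose psi w := if h w == 0 then dir (f 0) (f (L w)) else val (f ((h w)^-1 *: L w)).
exists m, psi; split.
- move=> u v u0 v0; rewrite /psi; split=> [|[a av]]; last first.
    have a0 : a != 0 by apply: contraNneq v0 => a0; rewrite av a0 scale0r.
    rewrite av hZ LZ mulf_eq0 (negbTE a0) /=; case: eqP => [hu|/eqP hu].
      by rewrite fZ // L_neq0.
    by rewrite scalerA invfM mulrAC mulVf // mul1r.
  case: eqP => [hu|/eqP hu]; case: eqP => [hv|/eqP hv] e.
  + have [a av] := (fP _ _ (L_neq0 u u0 hu) (L_neq0 v v0 hv)).1 e.
    by exists a; apply: LhP; rewrite ?LZ ?hZ // hu hv mulr0.
  + by have := neq_dir (f ((h v)^-1 *: L v)) (f 0) (f (L u)); rewrite e eqxx.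
  + by have := neq_dir (f ((h u)^-1 *: L u)) (f 0) (f (L v)); rewrite e eqxx.
  move/val_inj/finj: e => e; exists (h v / h u); apply: LhP.
    by rewrite LZ -scalerA e scalerA mulfV // scale1r.
  by rewrite hZ mulfVK.
- move=> x; have [f' fK f'K] := fbij; have [xH|xH] := boolP (x \in H); last first.
    pose u := row_mx (f' (Sub x xH)) (const_mx 1 : 'M[F]_(1, 1)).
    have hu : h u = 1 by rewrite /h row_mxKr mxE.
    exists u; last by rewrite /psi hu oner_eq0 invr1 scale1r /L row_mxKl f'K.
    by apply: contra_eq_neq hu => ->; rewrite /h !mxE eq_sym oner_neq0.
  (* Now [x] is at infinity. Its line to the origin [f 0] has q + 1 >= 3 points, and a third one
     supplies a nonzero vector with direction [x]. *)
  have q1 := finNzRing_gt1 F.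
  have [z] : exists z : P, z \in ln (val (f 0)) x :\ val (f 0) :\ x.
    apply/set0Pn; rewrite -card_gt0.
    have := card_line (ln_line (val (f 0)) x); rewrite (cardsD1 (val (f 0))) lnl.
    rewrite [#|_ :\ val (f 0)|](cardsD1 x) in_setD1 lnr andbT.
    have -> : x != val (f 0) by rewrite eq_sym memH_neq // (valP (f 0)).
    by rewrite !add1n => -[e]; move: q1; rewrite -e.
  rewrite !inE => /and3P[zx zf zl].
  have zH : z \notin H.
    apply: contra zx => zH; apply/eqP.
    exact: (ln_H_uniq (valP (f 0)) zl (lnr _ _) zH xH).
  pose u := row_mx (f' (Sub z zH)) (0 : 'M[F]_(1, 1)).
  have hu : h u = 0 by rewrite /h row_mxKr mxE.
  have Lu : L u = f' (Sub z zH) by rewrite /L row_mxKl.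
  exists u; last first.
    rewrite /psi hu eqxx Lu f'K; apply: dir_eq => //=.
    by apply: ln_swap zl; rewrite eq_sym.
  apply: contraNneq zf => u0; have : L u = 0 by rewrite u0 /L linear0.
  by rewrite Lu => f'z; rewrite -f'z f'K.
move=> S SP.
have sub_ln (x y z : P) : x != y -> x \in S -> y \in S -> z \in ln x y -> z \in S.
  by move=> xy xS yS; apply/subsetP/SP.
(* The point p + c w is on the line joining p to the point at infinity of w. *)
have aff_inf p w c : w != 0 -> c != 0 -> val (f p) \in S -> dir (f 0) (f w) \in S ->
    val (f (p + c *: w)) \in S.
  move=> w0 c0 pS dS; have cw0 : c *: w != 0 by rewrite scaler_eq0 negb_or c0.
  have pn : p != p + c *: w by rewrite -subr_eq0 opprD addrA subrr sub0r oppr_eq0.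
  apply: sub_ln (neq_dir _ (f 0) (f w)) pS dS _.
  have e : dir (f p) (f (p + c *: w)) = dir (f 0) (f w).
    by rewrite fB // addrAC subrr add0r fZ.
  by rewrite -e ln_dir lnr.
have psi_aff u : h u != 0 -> psi u = val (f ((h u)^-1 *: L u)).
  by rewrite /psi => /negbTE->.
have psi_inf u : h u = 0 -> psi u = dir (f 0) (f (L u)) by rewrite /psi => ->; rewrite eqxx.
have mixed u v : v != 0 -> h u != 0 -> h v = 0 -> psi u \in S -> psi v \in S ->
    psi (u + v) \in S.
  move=> v0 hu hv uS vS; have huv : h (u + v) = h u by rewrite hD hv addr0.
  rewrite psi_aff ?huv // LD scalerDr; rewrite psi_aff // in uS; rewrite psi_inf // in vS.
  by apply: aff_inf; rewrite ?L_neq0 // invr_eq0.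
move=> u v u0 v0 uv0 uS vS.
have [hu|hu] := eqVneq (h u) 0; have [hv|hv] := eqVneq (h v) 0; last first.
- rewrite psi_aff // in uS; rewrite psi_aff // in vS.
  set p := _ *: L u in uS; set r := _ *: L v in vS.
  have Lp : L u = h u *: p by rewrite scalerA mulfV ?scale1r.
  have Lr : L v = h v *: r by rewrite scalerA mulfV ?scale1r.
  clearbody p r.
  (* When the last coordinates cancel, the sum is the point at infinity of the line through the two
     affine points. *)
  have [huv|huv] := eqVneq (h u + h v) 0.
    have vu : h v = - h u by apply/eqP; rewrite -addr_eq0 addrC huv.
    have Luv : L (u + v) = h u *: (p - r) by rewrite LD Lp Lr vu scaleNr -scalerBr.
    have := L_neq0 (u + v) uv0; rewrite hD huv Luv => /(_ erefl).
    rewrite scaler_eq0 negb_or hu /= => pr0.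
    have pr : r != p by rewrite eq_sym -subr_eq0.
    rewrite psi_inf ?hD // Luv fZ // -fB //.
    by apply: sub_ln vS uS (dir_ln _ _); rewrite (inj_eq val_inj) fn.
  rewrite psi_aff ?hD // LD Lp Lr.
  (* The affine point of u + v is the barycentre of p and r with weights [h u] and [h v]. *)
  pose c := h v / (h u + h v).
  have -> : (h u + h v)^-1 *: (h u *: p + h v *: r) = p + c *: (r - p).
    have hc : (h u + h v)^-1 * h u = 1 - c.
      by rewrite -(mulfV huv) -mulrBl addrK mulrC.
    rewrite scalerDr !scalerA [_ * h v]mulrC -/c hc scalerBl scale1r scalerBr.
    by rewrite -addrA [- _ + _]addrC.
  have [->|pr] := eqVneq r p; first by rewrite subrr scaler0 addr0.
  apply: aff_inf => //; rewrite ?subr_eq0 // ?mulf_neq0 ?invr_eq0 //.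
  rewrite -fB 1?eq_sym //; apply: sub_ln uS vS (dir_ln _ _).
  by rewrite (inj_eq val_inj) fn // eq_sym.
- exact: mixed.
- by rewrite addrC; apply: mixed.
have huv : h (u + v) = 0 by rewrite hD hu hv addr0.
rewrite psi_inf // LD; rewrite psi_inf // in uS; rewrite psi_inf // in vS.
have Lu0 := L_neq0 u u0 hu; have Lv0 := L_neq0 v v0 hv.
have Luv0 := L_neq0 _ uv0 huv; rewrite LD in Luv0.
set w := L u in uS Lu0 Luv0 *; set w' := L v in vS Lv0 Luv0 *.
have [e|ne] := eqVneq (dir (f 0) (f w)) (dir (f 0) (f w')).
  have [a aw] := (fP _ _ Lu0 Lv0).1 e.
  rewrite aw -[X in X + _]scale1r -scalerDl fZ //.
  by apply: contraNneq Luv0 => a0; rewrite aw -[X in X + _]scale1r -scalerDl a0 scale0r.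
(* Two different points at infinity: in the plane of 0, w and w + w', the line from 0 to w + w'
   meets the line joining them, and it meets it at its own point at infinity. *)
have [p pp [p0 pw pww]] := plane_ex (val (f 0)) (val (f w)) (val (f (w + w'))).
have ww : w != w + w' by rewrite -subr_eq0 opprD addrA subrr sub0r oppr_eq0.
have e' : dir (f w) (f (w + w')) = dir (f 0) (f w') by rewrite fB // addrAC subrr add0r.
have nv (x y : 'rV_m) : x != y -> val (f x) != val (f y).
  by move=> xy; rewrite (inj_eq val_inj) fn.
have dp : dir (f 0) (f w) \in p.
  by apply: (subsetP (ln_plane pp (nv _ _ _) p0 pw) _ (dir_ln _ _)); rewrite eq_sym.
have dp' : dir (f 0) (f w') \in p.
  by rewrite -e'; apply: (subsetP (ln_plane pp (nv _ _ ww) pw pww) _ (dir_ln _ _)).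
have n0 : 0 != w + w' by rewrite eq_sym.
have [m' m1 m2] := plane_meet pp (ln_line _ _) (ln_line _ _)
  (ln_plane pp (nv _ _ n0) p0 pww) (ln_plane pp ne dp dp').
have m'H : m' \in H by apply: (subsetP (ln_H ne (dirH _ _) (dirH _ _))).
by rewrite (dir_eq m'H m1); apply: sub_ln uS vS m2.
Qed.

End ProjectiveSpace.

(** * From counting conditions to a projective space *)

(** The sets c minus a are disjoint parts of X minus a with enough elements to fill it. This turns
    uniqueness of joining flats into their existence. *)
Lemma cover_by_counting (P : finType) (B : {set {set P}}) (X a : {set P}) s :
  a \subset X -> {in B, forall c : {set P}, [/\ a \subset c, c \subset X & #|c| = s]} ->
  {in B &, forall c c' : {set P}, c != c' -> c :&: c' \subset a} ->
  (#|X| - #|a| <= #|B| * (s - #|a|))%N ->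
  forall x, x \in X -> x \notin a -> exists2 c, c \in B & x \in c.
Proof.
move=> aX Bc Bi le_X x xX xa.
have cDa c : c \in B -> #|c :\: a| = (s - #|a|)%N.
  by move=> /Bc[ac _ <-]; rewrite cardsD (setIidPr ac).
have inj : {in B &, injective (fun c => c :\: a)}.
  move=> c c' /Bc[ac _ _] /Bc[ac' _ _] e.
  by rewrite -(setID c a) -(setID c' a) e (setIidPr ac) (setIidPr ac').
pose C := [set c :\: a | c in B].
have tC : trivIset C.
  apply/trivIsetP=> _ _ /imsetP[c cB ->] /imsetP[c' cB' ->] ne.
  have cc' : c != c' by apply: contraNneq ne => ->.
  rewrite -setI_eq0; apply/eqP/setP=> y; rewrite !inE.
  apply/negP=> /andP[/andP[ya yc] /andP[_ yc']].
  by case/negP: ya; apply: (subsetP (Bi c c' cB cB' cc')); rewrite inE yc.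
have CX : cover C \subset X :\: a.
  apply/bigcupsP=> _ /imsetP[c /Bc[_ cX _] ->]; exact: setSD.
have /eqP XC : cover C == X :\: a.
  rewrite eqEcard CX cardsD (setIidPr aX) (leq_trans le_X) //.
  move/eqnP: tC => <-; rewrite big_imset //= (eq_bigr _ cDa) sum_nat_const //.
have : x \in cover C by rewrite XC inE xa.
by case/bigcupP=> _ /imsetP[c cB ->] /setDP[xc _]; exists c.
Qed.

Lemma card_homogeneous_preim (F : finFieldType) (P : finType) N (psi : 'rV[F]_N -> P)
    (a : {set P}) :
  (forall u v, u != 0%R -> v != 0%R -> psi u = psi v <-> exists c, (v = c *: u)%R) ->
  (forall x, exists2 u, u != 0%R & psi u = x) ->
  #|[set u | (u == 0%R) || (psi u \in a)]| = (1 + #|F|.-1 * #|a|)%N.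
Proof.
move=> h1 h2; rewrite (cardsD1 0%R) inE eqxx /=; congr (_ + _)%N.
rewrite -[LHS]sum1_card (partition_big psi (mem a)) /=; last first.
  by move=> u; rewrite !inE => /andP[/negbTE-> /=].
rewrite (eq_bigr (fun _ => #|F|.-1)); first by rewrite sum_nat_const mulnC.
move=> x xa; rewrite sum1_card; have [u u0 ux] := h2 x.
have inj : injective (fun c : F => (c *: u)%R).
  move=> c c' /eqP; rewrite -subr_eq0 -scalerBl scaler_eq0 (negbTE u0) orbF subr_eq0.
  by move/eqP.
rewrite -(cardC1 (0%R : F)) -(card_imset _ inj); apply: eq_card => v.
rewrite unfold_in /= !inE; apply/andP/imsetP => [[/andP[v0 _] /eqP vx]|[c]].
  have [c vc] := (h1 u v u0 v0).1 (etrans ux (esym vx)); exists c => //.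
  by rewrite !inE; apply: contraNneq v0 => c0; rewrite vc c0 scale0r.
rewrite !inE => c0 vc.
have v0 : v != 0%R by rewrite vc scaler_eq0 negb_or c0.
have <- : psi u = psi v by apply/h1 => //; exists c.
by rewrite v0 ux xa orbT.
Qed.

Section FlatSystem.

Variables (F : finFieldType) (n : nat) (P : finType) (Fl : nat -> {set {set P}}).
Local Notation q := #|F|.
Local Notation num k := (qbinom F k 1).

Hypothesis Fl_card : forall k, (k <= n)%N -> #|Fl k| = qbinom F n k.
Hypothesis Fl_size : forall k a, (k <= n)%N -> a \in Fl k -> #|a| = num k.
Hypothesis Fl_inter : forall j k a c, (j <= n)%N -> (k <= n)%N -> a \in Fl j -> c \in Fl k ->
  exists2 i, (i <= n)%N & a :&: c \in Fl i.
Hypothesis Fl_above : forall j k a, (j <= k)%N -> (k <= n)%N -> a \in Fl j ->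
  #|[set c in Fl k | a \subset c]| = qbinom F (n - j) (n - k).
Hypothesis Fl_point : forall x, [set x] \in Fl 1.
Hypothesis card_P : #|P| = num n.

Definition homogeneous_coordinates (psi : 'rV[F]_n -> P) : Prop :=
  [/\ forall u v, u != 0%R -> v != 0%R -> psi u = psi v <-> exists a, (v = a *: u)%R,
      forall x, exists2 u, u != 0%R & psi u = x
    & forall k S, (k <= n)%N -> S \in Fl k ->
      forall u v, u != 0%R -> v != 0%R -> (u + v)%R != 0%R ->
        psi u \in S -> psi v \in S -> psi (u + v)%R \in S].

Lemma num0 : num 0 = 0%N. Proof. exact: qbinom_small. Qed.
Lemma num1 : num 1 = 1%N. Proof. by rewrite qbinom1_recl num0 muln0. Qed.
Lemma num2 : num 2 = q.+1. Proof. by rewrite qbinom1_recl num1 muln1 addn1. Qed.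

Lemma Fl_sub_eq i k a c : (i <= n)%N -> (k <= i)%N -> a \in Fl i -> c \in Fl k ->
  a \subset c -> a = c.
Proof.
move=> le_in le_ki ai ck ac; have le_kn := leq_trans le_ki le_in; apply/eqP.
by rewrite eqEcard ac (Fl_size le_in ai) (Fl_size le_kn ck) qbinom1_mono.
Qed.

(** The intersection is a flat with at least two points, so its level is at least 2 and it is all of
    [l]. *)
Lemma line_in_flat k a l x y : (k <= n)%N -> (2 <= n)%N -> a \in Fl k -> l \in Fl 2 ->
  x != y -> x \in l -> y \in l -> x \in a -> y \in a -> l \subset a.
Proof.
move=> le_kn n2 ak l2 xy xl yl xa ya.
have [i le_in ai] := Fl_inter le_kn n2 ak l2.
have sub : [set x; y] \subset a :&: l.
  by apply/subsetP=> z /set2P[] ->; rewrite inE ?xl ?xa ?yl ?ya.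
have := subset_leq_card sub; rewrite cards2 xy (Fl_size le_in ai) => i2.
have le_2i : (2 <= i)%N.
  by rewrite leqNgt; apply: contraTN i2; case: i {le_in ai} => [|[|//]] _;
    rewrite ?num0 ?num1.
apply/setIidPr; apply: (Fl_sub_eq le_in le_2i ai l2); exact: subsetIr.
Qed.

(** The intersection contains [l] and is a flat. At level 2 it would equal [l] and miss [z]; at a
    higher level it equals both planes. *)
Lemma plane_uniq_flat p r l z : (3 <= n)%N -> p \in Fl 3 -> r \in Fl 3 -> l \in Fl 2 ->
  z \notin l -> l \subset p -> l \subset r -> z \in p -> z \in r -> p = r.
Proof.
move=> n3 p3 r3 l2 zl lp lr zp zr; have n2 := ltnW n3.
have [i le_in ai] := Fl_inter n3 n3 p3 r3.
have sub : l \subset p :&: r by rewrite subsetI lp.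
have := subset_leq_card sub.
rewrite (Fl_size n2 l2) (Fl_size le_in ai) qbinom1_mono leq_eqVlt => /predU1P[i2|i3].
  rewrite -i2 in ai; case/negP: zl.
  by rewrite (Fl_sub_eq n2 (leqnn 2) l2 ai sub) inE zp.
have e := Fl_sub_eq le_in i3 ai.
by rewrite -(e p p3 (subsetIl _ _)) (e r r3 (subsetIr _ _)).
Qed.

(** * Projective space axioms and coordinates for n >= 4 *)

Section Dim4.

Hypothesis n_ge4 : (4 <= n)%N.
Let n3 : (3 <= n)%N := ltnW n_ge4.
Let n2 : (2 <= n)%N := ltnW n3.
Let n1 : (1 <= n)%N := ltnW n2.

Lemma card_line_flat l : l \in Fl 2 -> #|l| = q.+1.
Proof. by move=> l2; rewrite (Fl_size n2 l2) num2. Qed.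

Lemma line_uniq_flat l m x y : l \in Fl 2 -> m \in Fl 2 -> x != y ->
  x \in l -> y \in l -> x \in m -> y \in m -> l = m.
Proof.
move=> l2 m2 xy xl yl xm ym; apply: (Fl_sub_eq n2 (leqnn 2) l2 m2).
exact: line_in_flat n2 n2 m2 l2 xy xl yl xm ym.
Qed.

Lemma num_recl : num n = (q * num n.-1).+1.
Proof. by rewrite -{1}(ltn_predK n1) qbinom1_recl addn1. Qed.

Lemma num_pred_recl : num n.-1 = (q * num n.-2).+1.
Proof.
have e : n.-1 = n.-2.+1 by lia.
by rewrite {1}e qbinom1_recl addn1.
Qed.

(** There are [num n.-1] lines through x, each with q further points, and q times [num n.-1] is
    exactly the number of points other than x. *)
Lemma line_ex_flat x y : exists2 l, l \in Fl 2 & x \in l /\ y \in l.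
Proof.
pose B := [set l in Fl 2 | [set x] \subset l].
have cB : #|B| = num n.-1.
  rewrite (Fl_above _ n2 (Fl_point x)) // -subn1 -[RHS]qbinom_sym; last by lia.
  by congr (qbinom F _ _); lia.
suff : y != x -> exists2 l, l \in B & y \in l.
  have [-> _|yx h] := eqVneq y x.
    have /card_gt0P[l] : (0 < #|B|)%N by rewrite cB; apply: qbinom_gt0; lia.
    by rewrite inE sub1set => /andP[l2 yl]; exists l.
  have [l] := h isT; rewrite inE sub1set => /andP[l2 xl] yl.
  by exists l.
move=> yx; apply: (@cover_by_counting _ B setT [set x] q.+1) => //.
- by move=> l; rewrite inE => /andP[l2 xl]; split; rewrite ?subsetT ?card_line_flat.
- move=> l m; rewrite !inE !sub1set => /andP[l2 xl] /andP[m2 xm] lm.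
  apply/subsetP=> z /setIP[zl zm]; rewrite inE; apply: contraNT lm => zx.
  by apply/eqP; apply: line_uniq_flat zx zl xl zm xm.
- by rewrite cardsT card_P cards1 cB num_recl !subn1 /= mulnC.
by rewrite inE.
Qed.

(** The same count around a line: [num n.-2] planes contain it, each with q^2 points off the
    line. *)
Lemma plane_ex_flat x y z : exists2 p, p \in Fl 3 & [/\ x \in p, y \in p & z \in p].
Proof.
have [l l2 [xl yl]] := line_ex_flat x y.
pose B := [set p in Fl 3 | l \subset p].
have cB : #|B| = num n.-2.
  rewrite (Fl_above _ n3 l2) // -subn2 -[RHS]qbinom_sym; last by lia.
  by congr (qbinom F _ _); lia.
suff : z \notin l -> exists2 p, p \in B & z \in p.
  have [zl _|zl h] := boolP (z \in l).
    have /card_gt0P[p] : (0 < #|B|)%N by rewrite cB; apply: qbinom_gt0; lia.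
    by rewrite inE => /andP[p3 /subsetP lp]; exists p => //; split; apply: lp.
  have [p] := h isT; rewrite inE => /andP[p3 /subsetP lp] zp.
  by exists p => //; split=> //; apply: lp.
move=> zl; apply: (@cover_by_counting _ B setT l (num 3)) => //.
- by move=> p; rewrite inE => /andP[p3 lp]; split; rewrite ?subsetT ?(Fl_size n3).
- move=> p r; rewrite !inE => /andP[p3 lp] /andP[r3 lr] pr.
  apply/subsetP=> u /setIP[up ur]; apply: contraNT pr => ul.
  by apply/eqP; apply: plane_uniq_flat p3 r3 l2 ul lp lr up ur.
- rewrite cardsT card_P (card_line_flat l2) cB num_recl num_pred_recl qbinom1_recl num2.
  nia.
Qed.

(** Y is a hyperplane of X by its size. For p on l off Y, the lines joining p to the points of Y
    cover X by counting, so l is one of them. The cases needed are a line in a plane and [H] in the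
    whole space. *)
Lemma lines_meet (X Y l : {set P}) :
  (forall m x y, m \in Fl 2 -> x != y -> x \in m -> y \in m ->
    x \in X -> y \in X -> m \subset X) ->
  (forall m x y, m \in Fl 2 -> x != y -> x \in m -> y \in m ->
    x \in Y -> y \in Y -> m \subset Y) ->
  Y \subset X -> #|X| = (q * #|Y|).+1 -> l \in Fl 2 -> l \subset X ->
  exists2 x, x \in l & x \in Y.
Proof.
move=> Xcl Ycl YX cX l2 lX.
have [lY|] := boolP (l \subset Y).
  have /card_gt0P[x xl] : (0 < #|l|)%N by rewrite card_line_flat.
  by exists x; rewrite ?(subsetP lY).
case/subsetPn=> p pl pY.
have [x] : exists x, x \in l :\ p.
  apply/card_gt0P; have := card_line_flat l2; rewrite (cardsD1 p) pl add1n => -[->].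
  by apply: ltnW; apply: finNzRing_gt1.
rewrite !inE => /andP[xp xl].
have lnP u v := lnP line_ex_flat u v.
pose B := [set ln (Fl 2) p y | y in Y].
have pne y : y \in Y -> p != y by move=> yY; apply: contraNneq pY => ->.
have cB : #|B| = #|Y|.
  apply: card_in_imset => y y' yY y'Y e; apply/eqP/negPn/negP => yy'.
  have [l1 p1 y1] := lnP p y; have [_ _ y2] := lnP p y'; rewrite -e in y2.
  by case/negP: pY; apply: (subsetP (Ycl _ _ _ l1 yy' y1 y2 yY y'Y)).
suff [_ /imsetP[y yY ->] xy] : exists2 c, c \in B & x \in c.
  exists y => //; have [l1 p1 y1] := lnP p y.
  by rewrite (line_uniq_flat l2 l1 xp xl pl xy p1).
apply: (@cover_by_counting _ B X [set p] q.+1).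
- by rewrite sub1set (subsetP lX).
- move=> _ /imsetP[y yY ->]; have [l1 p1 y1] := lnP p y.
  split; rewrite ?sub1set ?card_line_flat //.
  by apply: (Xcl _ _ _ l1 (pne y yY) p1 y1); rewrite ?(subsetP lX p pl) ?(subsetP YX).
- move=> _ _ /imsetP[y yY ->] /imsetP[y' y'Y ->] ne.
  have [l1 p1 y1] := lnP p y; have [l1' p1' y1'] := lnP p y'.
  apply/subsetP=> z /setIP[zl zm]; rewrite inE; apply: contraNT ne => zp.
  by apply/eqP; apply: line_uniq_flat zp zl p1 zm p1'.
- by rewrite cX cB cards1 !subn1 /= mulnC.
- exact: (subsetP lX).
- by rewrite inE.
Qed.

Lemma flat_homogeneous_coord : exists psi, homogeneous_coordinates psi.
Proof.
have n1n : (n.-1 <= n)%N by apply: leq_pred.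
have /card_gt0P[H Hn] : (0 < #|Fl n.-1|)%N by rewrite Fl_card // qbinom_gt0.
have flcl k S : (k <= n)%N -> S \in Fl k -> forall m x y, m \in Fl 2 -> x != y ->
    x \in m -> y \in m -> x \in S -> y \in S -> m \subset S.
  by move=> kn Sk m x y m2 xy xm ym xS yS; apply: line_in_flat kn n2 Sk m2 xy xm ym xS yS.
have plm p l m : p \in Fl 3 -> l \in Fl 2 -> m \in Fl 2 ->
    l \subset p -> m \subset p -> exists2 x, x \in l & x \in m.
  move=> p3 l2 m2 lp mp.
  apply: (@lines_meet p m l (flcl 3 p n3 p3) (flcl 2 m n2 m2)) => //.
  by rewrite (Fl_size n3 p3) qbinom1_recl (Fl_size n2 m2) addn1.
have Hm l : l \in Fl 2 -> exists2 x, x \in l & x \in H.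
  move=> l2; apply: (@lines_meet setT H l) => //; rewrite ?subsetT //.
  - exact: flcl n1n Hn.
  by rewrite cardsT card_P num_recl (Fl_size n1n Hn).
(* Here n >= 4 is decisive: [num 3] <= [num n.-1], so [p] and [H] together have at most 2 [num n.-1]
   points, fewer than q [num n.-1] + 1. *)
have off p : p \in Fl 3 -> exists2 x, x \notin p & x \notin H.
  move=> p3; have : exists x, x \notin p :|: H.
    apply/existsP; rewrite -negb_forall; apply/negP=> /forallP all.
    have PpH : [set: P] \subset p :|: H by apply/subsetP=> x _; apply: all.
    have := leq_trans (subset_leq_card PpH) (leq_card_setU p H).
    rewrite cardsT card_P num_recl (Fl_size n3 p3) (Fl_size n1n Hn).
    have : (num 3 <= num n.-1)%N by rewrite qbinom1_mono; lia.
    have q2 := finNzRing_gt1 F; rewrite -(subnKC q2).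
    by move: (num 3) (num n.-1) (q - 2)%N => t N r; nia.
  by case=> x; rewrite inE negb_or => /andP[]; exists x.
have /card_gt0P[p3 p33] : (0 < #|Fl 3|)%N by rewrite Fl_card // qbinom_gt0.
have [O _ OH] := off p3 p33.
have [m [psi [h1 h2 h3]]] := projective_coordinates line_ex_flat line_uniq_flat
  plane_ex_flat (fun p l x y p3 => flcl 3 p n3 p3 l x y)
  (fun p r l z => @plane_uniq_flat p r l z n3) plm
  (flcl n.-1 H n1n Hn) Hm off OH card_line_flat.
(* The dimension is found by counting: q^(m+1) = 1 + (q - 1) #|P| = q^n. *)
have mn : (m + 1)%N = n.
  apply/eqP; rewrite eq_sym -(expq_inj F) qbinom1 -card_P -cardsT.
  rewrite -(card_homogeneous_preim _ h1 h2) -[X in (_ ^ X)%N]mul1n -card_mx -cardsT.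
  by apply/eqP/eq_card => u; rewrite !inE orbT.
have h4 k S : (k <= n)%N -> S \in Fl k ->
    forall u v, u != 0%R -> v != 0%R -> (u + v)%R != 0%R ->
    psi u \in S -> psi v \in S -> psi (u + v)%R \in S.
  move=> kn Sk; apply: h3 => x y xS yS xy.
  have [l2 xl yl] := lnP line_ex_flat x y; exact: flcl kn Sk _ _ _ l2 xy xl yl xS yS.
by move: psi h1 h2 {h3} h4; rewrite mn => psi h1 h2 h4; exists psi.
Qed.

End Dim4.

(** For n <= 2 the only flats are the empty set, single points and the whole space, so any bijection
    from the lines of F^n to the points serves. *)
Lemma flat_homogeneous_coord_small : (0 < n < 3)%N -> exists psi, homogeneous_coordinates psi.
Proof.
case/andP=> n_gt0 n_lt3.
pose G := {U : {set 'rV[F]_n} | U \in Gr F n 1}.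
have cG : #|{: G}| = #|P| by rewrite card_sig card_P -card_Gr; apply: eq_card.
have Gv (u : 'rV[F]_n) : u != 0%R -> vecs u \in Gr F n 1.
  by move=> u0; have := vecs_Gr u; rewrite rank_rV u0.
pose b (g : G) : P := enum_val (cast_ord cG (enum_rank g)).
pose b' (x : P) : G := enum_val (cast_ord (esym cG) (enum_rank x)).
have bK : cancel b b' by move=> g; rewrite /b /b' enum_valK cast_ordK enum_rankK.
have b'K : cancel b' b by move=> x; rewrite /b /b' enum_valK cast_ordKV enum_rankK.
have /card_gt0P[P0 _] : (0 < #|P|)%N by rewrite card_P qbinom_gt0.
pose psi (u : 'rV[F]_n) := if insub (vecs u) is Some g then b g else P0.
have psiE u (u0 : u != 0%R) : psi u = b (Sub (vecs u) (Gv u u0)).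
  by rewrite /psi (insubT (fun U => U \in Gr F n 1) (Gv u u0)).
have h1 u v : u != 0%R -> v != 0%R -> psi u = psi v <-> exists a, (v = a *: u)%R.
  move=> u0 v0; rewrite !psiE; split=> [/(can_inj bK)/(congr1 val)/= e|[a av]].
    have : v \in vecs u by rewrite e inE.
    by rewrite inE => /sub_rVP[a ->]; exists a.
  congr b; apply/val_inj/eqP; rewrite /= eqEsubset !vecsS av scalemx_sub // andbT.
  have a0 : a != 0%R by apply: contraNneq v0 => a0; rewrite av a0 scale0r.
  by rewrite -{1}[u](scalerK a0) scalemx_sub.
exists psi; split=> //.
  move=> x; have GU := valP (b' x); set U := val (b' x) in GU.
  have cU := card_in_Gr GU; rewrite expn1 in cU.
  have [U0|[u]] := set_0Vmem (U :\ 0%R).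
    have := cardsD1 0%R U; rewrite U0 cards0 addn0 cU => e.
    by have := finNzRing_gt1 F; rewrite e; case: (_ \in _).
  rewrite !inE => /andP[u0 uU]; exists u; rewrite // psiE -[RHS]b'K; congr b.
  apply/val_inj/(Gr_sub_eq (Gv u u0) GU).
  by case/GrP: GU uU => A _ ->; rewrite inE vecsS.
move=> k S kn Sk u v u0 v0 uv0 uS vS.
have cS := Fl_size kn Sk.
have [k0|k_gt0] := posnP k.
  by move: cS; rewrite k0 num0 => /eqP; rewrite cards_eq0 => /eqP S0; rewrite S0 inE in uS.
have [kn'|kn'] := eqVneq k n.
  have -> : S = setT by apply/eqP; rewrite eqEcard subsetT cS cardsT card_P kn' leqnn.
  by rewrite inE.
have k1 : k = 1%N by lia.
have /eqP/cards1P[x Sx] : #|S| = 1%N by rewrite cS k1 num1.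
move: uS vS; rewrite Sx !inE => /eqP ux /eqP vx; apply/eqP.
have [a va] := (h1 u v u0 v0).1 (etrans ux (esym vx)).
rewrite -ux; apply/esym/h1 => //; exists (1 + a)%R.
by rewrite va scalerDl scale1r.
Qed.

Theorem flat_coordinates : (0 < n)%N -> n <> 3%N ->
  exists f : {set P} -> {set 'rV[F]_n},
  [/\ forall k, (k <= n)%N -> f @: Fl k = Gr F n k &
      forall j k a c, (j <= n)%N -> (k <= n)%N -> a \in Fl j -> c \in Fl k ->
        (f a \subset f c) = (a \subset c)].
Proof.
move=> n_gt0 n_neq3.
have [psi [h1 h2 h3]] : exists psi, homogeneous_coordinates psi.
  have [lt3|ge3] := ltnP n 3; first by apply: flat_homogeneous_coord_small; rewrite n_gt0.
  by apply: flat_homogeneous_coord; lia.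
pose f (a : {set P}) := [set u : 'rV[F]_n | (u == 0%R) || (psi u \in a)].
have fS a c : (f a \subset f c) = (a \subset c).
  apply/subsetP/subsetP => ac => [x xa|u]; last first.
    by rewrite !inE => /orP[->//|/ac ->]; rewrite orbT.
  have [u u0 ux] := h2 x; have := ac u.
  by rewrite !inE (negbTE u0) ux; apply.
have finj : injective f.
  by move=> a c e; apply/eqP; rewrite eqEsubset -!fS e subxx.
exists f; split=> [k kn|]; last by move=> *; exact: fS.
apply/eqP; rewrite eqEcard (etrans (card_imset _ finj) (Fl_card kn)) card_Gr leqnn andbT.
apply/subsetP=> _ /imsetP[a ak ->]; apply: subspace_Gr.
- by rewrite inE eqxx.
- move=> u v; rewrite !inE.
  have [->|u0] /= := eqVneq u 0%R; first by rewrite add0r.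
  have [->|v0] /= := eqVneq v 0%R; first by rewrite addr0 => ->; rewrite orbT.
  have [//|uv0] /= := eqVneq (u + v)%R 0%R; exact: h3 kn ak _ _ u0 v0 uv0.
- move=> c u; rewrite !inE.
  have [->|u0] /= := eqVneq u 0%R; first by rewrite scaler0 eqxx.
  have [->|c0] := eqVneq c 0%R; first by rewrite scale0r eqxx.
  have cu0 : (c *: u)%R != 0%R by rewrite scaler_eq0 negb_or c0.
  have <- : psi u = psi (c *: u)%R by apply/h1 => //; exists c.
  by move=> ->; rewrite orbT.
by rewrite (card_homogeneous_preim _ h1 h2) (Fl_size kn ak) qbinom1.
Qed.

End FlatSystem.

(** * The lattice of closed sets *)

Lemma qbinom_leq (F : finFieldType) m p k : (m <= p)%N -> (qbinom F m k <= qbinom F p k)%N.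
Proof.
move=> le_mp; rewrite -(card_Gr F p).
have rk : \rank (pid_mx m : 'M[F]_p) = m by rewrite rank_pid_mx.
rewrite -{1}rk -card_Gr_sub; apply/subset_leq_card/subsetP=> U.
by rewrite inE => /andP[].
Qed.

(** The sum over all levels of the counts in (iii): the outdegree and indegree of a vertex of level
    k. *)
Definition degree_at (F : finFieldType) n k :=
  (\sum_(j < n.+1) qbinom F n j * qbinom F (n - k) j)%N.

(** Every term weakly decreases in the level, and the term of index n - i is positive at level i but
    zero at level j. *)
Lemma degree_at_lt (F : finFieldType) n i j :
  (i < j)%N -> (j <= n)%N -> (degree_at F n j < degree_at F n i)%N.
Proof.
move=> lt_ij le_jn; rewrite /degree_at.
have lt_in : (n - i < n.+1)%N by rewrite ltnS leq_subr.
rewrite (bigD1 (Ordinal lt_in)) //= [X in (_ < X)%N](bigD1 (Ordinal lt_in)) //=.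
rewrite (@qbinom_small F (n - j)) ?muln0 ?add0n; last by lia.
rewrite -add1n leq_add //; first by rewrite muln_gt0 !qbinom_gt0 ?leq_subr.
by apply: leq_sum => k _; rewrite leq_mul // qbinom_leq //; lia.
Qed.

Lemma degree_at_le (F : finFieldType) n i j :
  (i <= n)%N -> (j <= n)%N -> (degree_at F n i <= degree_at F n j)%N = (j <= i)%N.
Proof.
move=> le_in le_jn; have [lt_ij|le_ji] := ltnP i j.
  by apply/negbTE; rewrite -ltnNge degree_at_lt.
move: le_ji; rewrite leq_eqVlt => /predU1P[->|lt]; first exact: leqnn.
by rewrite ltnW // degree_at_lt.
Qed.

Definition rev_digraph (G : digraph) : digraph :=
  @Digraph (vertex G) (fun u v => edge v u).

Section Closures.

Variable G : digraph.
Implicit Types (x y z : G) (X Y : {set G}).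

Lemma in_out1 x y : (y \in outnbr [set x]) = edge x y.
Proof.
by rewrite inE; apply/forall_inP/idP => [h|xy z /set1P->//]; apply/h/set11.
Qed.

Lemma in_in1 x y : (y \in innbr [set x]) = edge y x.
Proof.
by rewrite inE; apply/forall_inP/idP => [h|xy z /set1P->//]; apply/h/set11.
Qed.

Lemma galois X Y : (X \subset innbr Y) = (Y \subset outnbr X).
Proof.
apply/subsetP/subsetP => h z zZ; rewrite inE; apply/forall_inP => w wW.
  by have := h w wW; rewrite inE => /forall_inP; apply.
by have := h w wW; rewrite inE => /forall_inP; apply.
Qed.

Lemma out_closed X : outnbr (innbr (outnbr X)) = outnbr X.
Proof.
have sub2 : outnbr X \subset outnbr (innbr (outnbr X)) by rewrite -galois.
apply/eqP; rewrite eqEsubset sub2 andbT.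
have sub : X \subset innbr (outnbr X) by rewrite galois.
apply/subsetP=> z; rewrite !inE => /forall_inP h; apply/forall_inP=> x /(subsetP sub).
exact: h.
Qed.

Lemma out_union X Y : outnbr (X :|: Y) = outnbr X :&: outnbr Y.
Proof.
apply/setP=> z; rewrite !inE; apply/forall_inP/andP => [h|[/forall_inP hX /forall_inP hY]].
  by split; apply/forall_inP => x xX; apply: h; rewrite inE xX ?orbT.
by move=> x /setUP[/hX|/hY].
Qed.

Lemma in_tcl x y : (y \in target_closure [set x]) = (innbr [set x] \subset innbr [set y]).
Proof. by rewrite galois sub1set. Qed.

End Closures.

Lemma in_closed (G : digraph) (X : {set G}) : innbr (outnbr (innbr X)) = innbr X.
Proof. exact: (@out_closed (rev_digraph G)). Qed.

Section Levels.

Variables (F : finFieldType) (n : nat).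

(* The five properties with V_k = [set x | lv x == k], in a form that is symmetric
   under reversal of the edges, so that each fact has a dual for free. *)
Record levelled (G : digraph) (lv : G -> nat) : Prop := Levelled {
  lv_le : forall x, (lv x <= n)%N;
  lv_card : forall k, (k <= n)%N -> #|[set x | lv x == k]| = (qbinom F n k ^ 2)%N;
  lv_count : forall j x, (j <= n)%N ->
    #|outnbr [set x] :&: [set y | lv y == j]| = (qbinom F n j * qbinom F (n - lv x) j)%N /\
    #|innbr [set x] :&: [set y | lv y == j]| = (qbinom F n j * qbinom F (n - lv x) j)%N;
  lv_principal : (forall X : {set G}, exists x, outnbr X = target_closure [set x]) /\
    (forall X : {set G}, exists x, innbr X = source_closure [set x]);
  lv_once : forall x y, lv x = lv y ->
    #|target_closure [set x] :&: source_closure [set y] :&: [set z | lv z == lv x]| = 1%N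
}.

Lemma levelled_rev G lv : @levelled G lv -> @levelled (rev_digraph G) lv.
Proof.
case=> h1 h2 h3 [h4 h4'] h5; split=> // [j x jn|x y xy].
  by have [] := h3 j x jn.
have := h5 y x (esym xy); rewrite -xy => <-; congr #|pred_of_set (_ :&: _)|.
exact: setIC.
Qed.

Section OneSide.

Variables (G : digraph) (lv : G -> nat).
Hypothesis LV : levelled lv.
Local Notation V k := [set x | lv x == k].
Local Notation t x := (target_closure [set x]).
Local Notation s x := (source_closure [set x]).
Local Notation I x := (innbr [set x]).
Local Notation O x := (outnbr [set x]).
Implicit Types (x y z w : G).

Lemma card_in_nbr x : #|I x| = degree_at F n (lv x).
Proof.
rewrite -sum1_card (partition_big (fun y => inord (lv y) : 'I_n.+1) predT) //=.
apply: eq_bigr => j _; rewrite sum1_card.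
have [_ <-] := lv_count LV x (ltn_ord j); apply: eq_card => y.
rewrite unfold_in /= !in_setI inE; congr (_ && _).
by rewrite -val_eqE /= inordK // ltnS (lv_le LV).
Qed.

(** Membership means that N^-(x) is contained in N^-(y), and larger indegree means smaller level.
    Equal levels force equality, as [tcl_eq] records. *)
Lemma tcl_level x y : y \in t x -> (lv y <= lv x)%N.
Proof.
by rewrite in_tcl => /subset_leq_card; rewrite !card_in_nbr degree_at_le ?(lv_le LV).
Qed.

Lemma tcl_eq x y : y \in t x -> lv y = lv x -> I y = I x.
Proof.
rewrite in_tcl => sub e; apply/esym/eqP; rewrite eqEcard sub !card_in_nbr e.
exact: leqnn.
Qed.

Lemma tcl_refl x : x \in t x. Proof. by rewrite in_tcl. Qed.

(** N^+(x) is the closure of some w, and w has the highest level in its closure. By (iii) N^+(x)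
    meets level n - [lv x] and no higher one. *)
Lemma out_tcl x : exists2 w, lv w = (n - lv x)%N & O x = t w.
Proof.
have [w Ox] := (lv_principal LV).1 [set x]; exists w => //; apply/eqP.
have le_wn := lv_le LV w; have le_nx := leq_subr (lv x) n; rewrite eqn_leq.
apply/andP; split.
  have [c _] := lv_count LV x le_wn.
  rewrite leqNgt; apply/negP=> lt; move: c; rewrite [X in (_ * X)%N]qbinom_small // muln0.
  by move/eqP; rewrite cards_eq0 => /eqP/setP/(_ w); rewrite in_setI Ox tcl_refl !inE eqxx.
have [c _] := lv_count LV x le_nx.
have /card_gt0P[w'] : (0 < #|O x :&: V (n - lv x)|)%N by rewrite c muln_gt0 !qbinom_gt0.
by rewrite Ox in_setI inE => /andP[/tcl_level le_w'w /eqP <-].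
Qed.

(** The hypothesis is the conclusion of [out_tcl] in the reversed graph. It gives cl_t(x) =
    N^+(N^-(x)) = N^+(cl_s(u)) = N^+(u). *)
Lemma tcl_out_rev x : (exists2 u, lv u = (n - lv x)%N & I x = s u) ->
  exists2 u, lv u = (n - lv x)%N & t x = O u.
Proof.
case=> u lu e; exists u => //.
by rewrite /target_closure e /source_closure out_closed.
Qed.

End OneSide.

Section TwoSides.

Variables (G : digraph) (lv : G -> nat).
Hypothesis LV : levelled lv.
Local Notation V k := [set x | lv x == k].
Local Notation t x := (target_closure [set x]).
Local Notation s x := (source_closure [set x]).
Local Notation I x := (innbr [set x]).
Local Notation O x := (outnbr [set x]).
Implicit Types (x y z w : G) (a c : {set G}).

Lemma tcl_out x : exists2 u, lv u = (n - lv x)%N & t x = O u.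
Proof. by apply: tcl_out_rev; apply: (out_tcl (levelled_rev LV)). Qed.

Lemma in_tclE x y : (y \in t x) = (t y \subset t x).
Proof.
rewrite in_tcl; apply/idP/idP => [sub|/subsetP/(_ y (tcl_refl y))]; last by rewrite in_tcl.
by rewrite /target_closure -galois in_closed.
Qed.

Lemma innbr_tcl x : innbr (t x) = I x.
Proof. exact: in_closed. Qed.

Lemma tcl_eqE x y : (t x == t y) = (I x == I y).
Proof.
apply/eqP/eqP => [e|e]; last by rewrite /target_closure e.
by rewrite -innbr_tcl e innbr_tcl.
Qed.

(** Property (v) puts one vertex of this level in cl_t(x) and cl_s(y), and within a level membership
    in a closure means having the same closure. *)
Lemma vertex_ex x y : lv x = lv y -> exists z, [/\ lv z = lv x, t z = t x & O z = O y].
Proof.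
move=> e; have /eqP/cards1P[z zE] := lv_once LV e.
have : z \in [set z] by apply: set11.
rewrite -zE !in_setI inE => /andP[/andP[zt zs] /eqP lz]; exists z; split=> //.
  by apply/eqP; rewrite tcl_eqE (tcl_eq LV zt).
by apply: (tcl_eq (levelled_rev LV) zs); rewrite lz.
Qed.

Lemma vertex_uniq x y : lv x = lv y -> t x = t y -> O x = O y -> x = y.
Proof.
move=> e tt oo; have /eqP/cards1P[z zE] := lv_once LV (erefl (lv x)).
have : x \in [set z].
  by rewrite -zE !in_setI inE tcl_refl (tcl_refl (G := rev_digraph G)) eqxx.
have : y \in [set z].
  rewrite -zE !in_setI inE -e eqxx tt tcl_refl /source_closure oo.
  by rewrite [X in _ && X && _](tcl_refl (G := rev_digraph G)).
by move=> /set1P-> /set1P.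
Qed.

Definition flats k : {set {set G}} := [set t x | x in V k].

Lemma flatsP k a : reflect (exists2 x, lv x = k & a = t x) (a \in flats k).
Proof.
apply: (iffP imsetP) => [[x]|[x <- ->]]; last by exists x; rewrite ?inE.
by rewrite inE => /eqP lx ->; exists x.
Qed.

Lemma flat_eq k a c : a \in flats k -> c \in flats k -> a \subset c -> a = c.
Proof.
move=> /flatsP[x lx ->] /flatsP[y ly ->]; rewrite -in_tclE => xy.
by apply/eqP; rewrite tcl_eqE (tcl_eq LV xy) // lx.
Qed.

(** The closure [a] is N^+(u) for a vertex u of level n - k, so (iii) counts its vertices of level
    k; these are the ones whose closure is [a]. *)
Lemma card_tcl_fibre k a : a \in flats k ->
  #|[set z in V k | t z == a]| = qbinom F n k.
Proof.
case/flatsP=> x lx ->; have [u lu tu] := tcl_out x.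
have le_kn : (k <= n)%N by rewrite -lx (lv_le LV).
have [c _] := lv_count LV u le_kn; rewrite lu lx subKn // qbinom_n muln1 in c.
rewrite -c -tu; apply: eq_card => z; rewrite in_setI in_tclE !inE -in_tclE andbC.
have [lz|] := eqVneq (lv z) k; rewrite ?andbF // !andbT.
apply/eqP/idP => [<-|zx]; first exact: tcl_refl.
by apply/eqP; rewrite tcl_eqE (tcl_eq LV zx) // lz.
Qed.

(** Writing [a] as N^+(u), property (iii) counts its vertices of level j; divide by the size of a
    fibre. In [card_flats] the same division is applied to (ii). *)
Lemma card_flats_sub j m a : (j <= n)%N -> a \in flats m ->
  #|[set c in flats j | c \subset a]| = qbinom F m j.
Proof.
move=> le_jn /flatsP[x lx ->]; have [u lu tu] := tcl_out x.
have le_mn : (m <= n)%N by rewrite -lx (lv_le LV).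
have [c _] := lv_count LV u le_jn; rewrite lu lx subKn // in c.
apply/eqP; rewrite -(eqn_pmul2l (qbinom_gt0 F le_jn)) -c -tu.
rewrite -[X in _ == X]sum1_card.
rewrite (partition_big (fun z => t z) (mem [set c in flats j | c \subset t x])) /=.
  rewrite (eq_bigr (fun _ => qbinom F n j)) ?sum_nat_const 1?mulnC // => b.
  rewrite inE => /andP[bj bx]; rewrite sum1_card -(card_tcl_fibre bj).
  apply: eq_card => z; rewrite unfold_in /= in_setI in_tclE !inE.
  have [zb|] := eqVneq (t z) b; rewrite ?andbF // !andbT.
  by rewrite zb bx.
move=> z; rewrite in_setI inE => /andP[zx /eqP lz]; rewrite inE -in_tclE zx andbT.
by apply/flatsP; exists z.
Qed.

Lemma card_flats k : (k <= n)%N -> #|flats k| = qbinom F n k.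
Proof.
move=> le_kn; apply/eqP; rewrite -(eqn_pmul2r (qbinom_gt0 F le_kn)) mulnn -(lv_card LV le_kn).
rewrite -[X in _ == X]sum1_card (partition_big (fun z => t z) (mem (flats k))) /=.
  rewrite (eq_bigr (fun _ => qbinom F n k)) ?sum_nat_const // => b bk.
  rewrite sum1_card -(card_tcl_fibre bk); apply: eq_card => z.
  by rewrite unfold_in /= !inE.
by move=> z; rewrite inE => /eqP lz; apply/flatsP; exists z.
Qed.

Lemma flats_inter j k a c : a \in flats j -> c \in flats k ->
  exists2 i, (i <= n)%N & a :&: c \in flats i.
Proof.
move=> /flatsP[x _ ->] /flatsP[y _ ->]; rewrite /target_closure -out_union.
have [w ->] := (lv_principal LV).1 (I x :|: I y); exists (lv w); first exact: (lv_le LV).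
by apply/flatsP; exists w.
Qed.

Lemma innbr_flats k a : a \in flats k ->
  exists2 v, lv v = (n - k)%N & innbr a = s v.
Proof.
case/flatsP=> x <- ->; rewrite innbr_tcl; exact: (out_tcl (levelled_rev LV)).
Qed.

End TwoSides.

(** N^- reverses inclusions and sends flats of level k to flats of level n - k of the reversed
    graph, so this is [card_flats_sub] there. *)
Lemma card_flats_above (G : digraph) (lv : G -> nat) j k a :
  levelled lv -> (j <= n)%N -> (k <= n)%N -> a \in flats lv j ->
  #|[set c in flats lv k | a \subset c]| = qbinom F (n - j) (n - k).
Proof.
move=> LV le_jn le_kn aj; have LV' := levelled_rev LV.
have [v lv_v ev] := innbr_flats LV aj.
have flK i c : c \in flats lv i -> outnbr (innbr c) = c.
  by case/flatsP=> x _ ->; apply: out_closed.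
have a' : innbr a \in @flats (rev_digraph G) lv (n - j).
  by apply/flatsP; exists v.
rewrite -(card_flats_sub LV' (leq_subr k n) a').
have inj : {in [set c in flats lv k | a \subset c] &, injective (@innbr G)}.
  move=> c d; rewrite !inE => /andP[ck _] /andP[dk _] e.
  by rewrite -(flK k c) // e (flK k).
rewrite -(card_in_imset inj); apply: eq_card => c'; rewrite inE.
apply/imsetP/andP => [[c]|[/flatsP[w lw c'E] c'a]].
  rewrite inE => /andP[ck ac] ->; split.
    by have [w lw ew] := innbr_flats LV ck; apply/flatsP; exists w.
  have : innbr c \subset innbr a by rewrite galois (flK k).
  exact: id.
have [u lu eu] := tcl_out LV' w.
exists (outnbr c'); last by rewrite c'E eu [RHS](in_closed (G := G)).
rewrite inE -galois c'a andbT c'E eu; apply/flatsP; exists u => //.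
by rewrite lu lw subKn.
Qed.

End Levels.

(** * Translation between the five properties and level functions *)

Section FiveProperties.

Variables (F : finFieldType) (n : nat) (G : digraph).

Lemma five_levelled : five_properties n F G -> exists lv : G -> nat, levelled F n lv.
Proof.
case=> -[_ sz] h2 h3 [h4 h4'] h5; pose lv x := index (@outdegree G x) (outdegrees G).
have lv_le x : (lv x <= n)%N.
  by rewrite -ltnS -sz index_mem mem_sort mem_undup map_f ?mem_enum.
have lvE k : (k <= n)%N -> [set x | lv x == k] = level G k.
  move=> le_kn; apply/setP=> x; rewrite !inE sz ltnS le_kn /=.
  apply/eqP/eqP => [<-|e].
    by rewrite nth_index // mem_sort mem_undup map_f ?mem_enum.
  by rewrite /lv e index_uniq ?sz // sort_uniq undup_uniq.
exists lv; split=> //.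
- by move=> k le_kn; rewrite lvE // h2.
- by move=> j x le_jn; rewrite lvE //; apply: h3; rewrite // -lvE // inE.
(* A set of the form N^+(X) is target-closed, so (iv) applies to it. *)
- split=> X; first by apply: h4; apply: out_closed.
  by apply: h4'; apply: in_closed.
by move=> x y e; rewrite lvE //; apply: h5; rewrite // -lvE // inE // e.
Qed.

(** The point is that ranking by outdegree gives back [lv]: all levels are inhabited and [degree_at]
    strictly decreases, so the sorted outdegrees are its values at 0, ..., n. *)
Lemma levelled_five (lv : G -> nat) : levelled F n lv -> five_properties n F G.
Proof.
move=> LV.
have od x : outdegree x = degree_at F n (lv x).
  rewrite -(card_in_nbr (levelled_rev LV) x); apply: eq_card => y.
  by rewrite inE -in_out1.
have V_gt0 k : (k <= n)%N -> exists x, lv x = k.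
  move=> le_kn; have /card_gt0P[x] : (0 < #|[set x | lv x == k]|)%N.
    by rewrite (lv_card LV le_kn) expn_gt0 qbinom_gt0.
  by rewrite inE => /eqP; exists x.
have deg_inj i j : (i <= n)%N -> (j <= n)%N -> degree_at F n i = degree_at F n j -> i = j.
  move=> ni nj e; apply/eqP; rewrite eqn_leq -(degree_at_le F nj ni) -(degree_at_le F ni nj) e.
  by rewrite leqnn.
have odsE : outdegrees G = [seq degree_at F n k | k <- iota 0 n.+1].
  apply: (@sorted_eq _ geq).
  - by move=> i j k ji ki; apply: leq_trans ki ji.
  - by move=> i j; rewrite /geq /= -eqn_leq => /eqP.
  - by apply: sort_sorted => i j; apply: leq_total.
  - apply/(sortedP 0%N) => i; rewrite size_map size_iota => lt_in.
    rewrite !(nth_map 0%N) ?size_iota // ?nth_iota // 1?ltnW // !add0n /geq /=.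
    by rewrite degree_at_le //; lia.
  rewrite perm_sort; apply: uniq_perm; first exact: undup_uniq.
    rewrite map_inj_in_uniq ?iota_uniq // => i j; rewrite !mem_iota !ltnS => ni nj.
    exact: deg_inj.
  move=> d; rewrite mem_undup; apply/mapP/mapP => [[x _ ->]|[k]].
    by exists (lv x); rewrite ?od // mem_iota ltnS (lv_le LV).
  rewrite mem_iota ltnS => /= /V_gt0[x <-] ->.
  by exists x; rewrite ?mem_enum ?od.
have sz : size (outdegrees G) = n.+1 by rewrite odsE size_map size_iota.
have lvE k : (k <= n)%N -> level G k = [set x | lv x == k].
  move=> le_kn; apply/setP=> x; rewrite !inE sz ltnS le_kn /= odsE.
  rewrite (nth_map 0%N) ?size_iota // nth_iota // od; apply/eqP/eqP => [|->//].
  exact: deg_inj (lv_le LV x) le_kn.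
split.
- split=> //; apply/setP=> x; rewrite inE; apply/esym/bigcupP.
  have lt : (lv x < n.+1)%N by rewrite ltnS (lv_le LV).
  by exists (Ordinal lt) => //=; rewrite lvE ?inE.
- by move=> k le_kn; rewrite lvE ?(lv_card LV).
- move=> j k le_jn le_kn x; rewrite !lvE // inE => /eqP <-; exact: (lv_count LV).
- by split=> X <-; [apply: (lv_principal LV).1|apply: (lv_principal LV).2].
move=> k le_kn x y; rewrite lvE // !inE => /eqP lx /eqP ly.
by rewrite -lx; apply: (lv_once LV); rewrite lx.
Qed.

End FiveProperties.

(* A vertex (U, W) stands for x with cl_t(x) = U and N^+(x) = W. *)
Definition complementary_pair (F : finFieldType) n
    (p : {set 'rV[F]_n} * {set 'rV[F]_n}) : bool :=
  [exists k : 'I_n.+1, (p.1 \in Gr F n k) && (p.2 \in Gr F n (n - k))].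

Definition subspace_graph (F : finFieldType) n : digraph :=
  @Digraph {p : {set 'rV[F]_n} * {set 'rV[F]_n} | complementary_pair p}
    (fun p r => (val r).1 \subset (val p).2).

Theorem levelled_iso (F : finFieldType) n (G : digraph) (lv : G -> nat) :
  (0 < n)%N -> n <> 3%N -> levelled F n lv -> digraph_iso G (subspace_graph F n).
Proof.
move=> n_gt0 n_neq3 LV.
pose P := {a : {set G} | a \in flats lv 1}.
pose pt (a : {set G}) := [set p : P | val p \subset a].
pose FL k := [set pt a | a in flats lv k].
have ptI a c : pt a :&: pt c = pt (a :&: c).
  by apply/setP=> p; rewrite !inE subsetI.
have card_pt k a : a \in flats lv k -> #|pt a| = qbinom F k 1.
  move=> ak; rewrite -(card_flats_sub LV n_gt0 ak).
  rewrite -(card_imset _ val_inj); apply: eq_card => c; rewrite !inE.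
  apply/imsetP/andP => [[p]|[c1 ca]]; first by rewrite inE => pa ->; rewrite (valP p).
  by exists (Sub c c1); rewrite ?inE.
have ptS j k a c : a \in flats lv j -> c \in flats lv k -> (pt a \subset pt c) = (a \subset c).
  move=> aj ck; apply/idP/idP => [sub|ac]; last first.
    by apply/subsetP=> p; rewrite !inE => pa; exact: (subset_trans pa ac).
  (* If the points of [a] lie in [c], the flat [a :&: c] has as many points as [a], hence the same
     level, and so equals [a]. *)
  have [i _ aci] := flats_inter LV aj ck.
  have ij : i = j.
    have := card_pt _ _ aci; rewrite -ptI (setIidPl sub) (card_pt _ _ aj) => /eqP.
    by rewrite eqn_leq !qbinom1_mono -eqn_leq => /eqP.
  by rewrite -(flat_eq LV _ aj (subsetIl a c)) ?subsetIr // -ij.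
have pt_inj k : {in flats lv k &, injective pt}.
  move=> a c ak ck e; apply/eqP.
  by rewrite eqEsubset -(ptS _ _ _ _ ak ck) -(ptS _ _ _ _ ck ak) e subxx.
have [|||||| f [fG fS]] := @flat_coordinates F n P FL _ _ _ _ _ _ n_gt0 n_neq3.
- by move=> k kn; rewrite card_in_imset ?(card_flats LV) //; apply: pt_inj.
- by move=> k _ kn /imsetP[a ak ->]; rewrite (card_pt k).
- move=> j k _ _ jn kn /imsetP[a aj ->] /imsetP[c ck ->].
  have [i le_in aci] := flats_inter LV aj ck.
  by exists i => //; rewrite ptI imset_f.
- move=> j k _ jk kn /imsetP[a aj ->]; have jn := leq_trans jk kn.
  rewrite -(card_flats_above LV jn kn aj).
  have inj : {in [set c in flats lv k | a \subset c] &, injective pt}.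
    by move=> c d; rewrite !inE => /andP[ck _] /andP[dk _]; exact: (pt_inj k).
  rewrite -(card_in_imset inj); apply: eq_card => d; rewrite !inE.
  apply/andP/imsetP => [[/imsetP[c ck ->]]|[c]].
    by rewrite (ptS _ _ _ _ aj ck) => ac; exists c; rewrite ?inE ?ck.
  by rewrite inE => /andP[ck ac] ->; rewrite (ptS _ _ _ _ aj ck) imset_f.
- move=> p; have -> : [set p] = pt (val p); last by rewrite imset_f // (valP p).
  apply/setP=> r; rewrite !inE; apply/eqP/idP => [->//|rp].
  exact/val_inj/(flat_eq LV (valP r) (valP p) rp).
- by rewrite card_sig -(card_flats LV n_gt0); apply: eq_card.
pose h a := f (pt a).
have hG k a : (k <= n)%N -> a \in flats lv k -> h a \in Gr F n k.
  by move=> kn ak; rewrite -fG // /h imset_f // imset_f.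
have hS j k a c : (j <= n)%N -> (k <= n)%N -> a \in flats lv j -> c \in flats lv k ->
    (h a \subset h c) = (a \subset c).
  by move=> jn kn aj ck; rewrite -(ptS _ _ _ _ aj ck); apply: (fS j k); rewrite ?imset_f.
pose t x := target_closure [set x : G]; pose O x := outnbr [set x : G].
have tk x : t x \in flats lv (lv x) by apply/flatsP; exists x.
have Ok x : O x \in flats lv (n - lv x).
  by have [w lw Ow] := out_tcl LV x; apply/flatsP; exists w.
have len x := lv_le LV x.
have tO x y : edge x y = (t y \subset O x).
  rewrite -in_out1 -/(O x); have [w lw Ow] := out_tcl LV x.
  by rewrite /O Ow in_tclE.
have cp x : complementary_pair (h (t x), h (O x)).
  have lt : (lv x < n.+1)%N by rewrite ltnS len.
  by apply/existsP; exists (Ordinal lt); rewrite /= !hG ?leq_subr.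
pose phi (x : G) : subspace_graph F n := Sub (h (t x), h (O x)) (cp x).
have phiE x y : edge (phi x) (phi y) = edge x y.
  by rewrite tO /= (hS (lv y) (n - lv x)%N) ?leq_subr.
have h_inj j k a c : (j <= n)%N -> (k <= n)%N -> a \in flats lv j -> c \in flats lv k ->
    h a = h c -> a = c.
  move=> jn kn aj ck e; apply/eqP.
  by rewrite eqEsubset -(hS j k) // -(hS k j) // e subxx.
have phi_inj : injective phi.
  move=> x y /(congr1 val)/= [et eO].
  have ett := h_inj _ _ _ _ (len x) (len y) (tk x) (tk y) et.
  have eOO := h_inj _ _ _ _ (leq_subr _ _) (leq_subr _ _) (Ok x) (Ok y) eO.
  apply: (vertex_uniq LV) ett eOO.
  by apply: (@Gr_uniq F n); [apply: hG (tk x)|rewrite et; apply: hG (tk y)].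
have phi_surj (v : subspace_graph F n) : exists x, phi x = v.
  case: v => -[U W] UW; have /existsP[k /andP[/= Uk Wk]] := UW.
  have kn : (k <= n)%N by rewrite -ltnS.
  have hex i A : (i <= n)%N -> A \in Gr F n i -> exists2 x, lv x = i & h (t x) = A.
    move=> le_in; rewrite -fG // => /imsetP[_ /imsetP[a /flatsP[x lx ->] ->] ->].
    by exists x.
  (* Choose x with closure over U, and y whose out-neighbourhood is the flat over W; both have level
     k, so [vertex_ex] merges them into one vertex. *)
  have [x lx hx] := hex k U kn Uk.
  have [w lw hw] := hex _ W (leq_subr _ _) Wk.
  have [y ly ty] := tcl_out LV w.
  have [|z [lz tz Oz]] := @vertex_ex _ _ _ _ LV x y; first by rewrite lx ly lw subKn.
  by exists z; apply: val_inj; rewrite /= /t /O tz Oz -ty -/(t x) -/(t w) hx hw.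
have /fin_all_exists[g gK] := phi_surj.
exists phi => //; exists g => // x; exact/phi_inj/gK.
Qed.

(** * The graph of a matrix ring *)

Section MatrixRing.

Local Open Scope ring_scope.

Lemma vecs_eqmx (F : finFieldType) m p n (A : 'M[F]_(m, n)) (B : 'M[F]_(p, n)) :
  reflect (A :=: B)%MS (vecs A == vecs B).
Proof.
rewrite eqEsubset !vecsS; apply: (iffP idP) => [/eqmxP//|AB].
by rewrite AB submx_refl -AB submx_refl.
Qed.

Section SubspaceLabels.

Variables (F : finFieldType) (n : nat) (G : digraph) (ka K : G -> {set 'rV[F]_n}).

Hypothesis edgeE : forall A B, edge A B = (ka B \subset K A).
Hypothesis K_space : forall A, exists M : 'M[F]_n, K A = vecs M.
Hypothesis ka_onto : forall M : 'M[F]_n, exists A, ka A = vecs M.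
Hypothesis K_onto : forall M : 'M[F]_n, exists A, K A = vecs M.
Hypothesis ka_space : forall A, exists M : 'M[F]_n, ka A = vecs M.

(** Some vertex has as its [K] the subspace [ka x]; it is an in-neighbour of x and detects the
    inclusion. The labels will be column spaces with right kernels, and, in the reversed graph, row
    spaces with left kernels. *)
Lemma tcl_label x : target_closure [set x] = [set B | ka B \subset ka x].
Proof.
apply/setP=> B; rewrite [in RHS]inE in_tcl; apply/subsetP/idP => [h|sub A].
  have [M kx] := ka_space x; have [A KA] := K_onto M.
  by have := h A; rewrite !in_in1 !edgeE KA kx subxx => ->.
rewrite !in_in1 !edgeE; exact: subset_trans.
Qed.

(** The common out-neighbours are the vertices whose label lies in the intersection of the [K A],
    which is again the label of a vertex. *)
Lemma out_label (X : {set G}) : exists x, outnbr X = target_closure [set x].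
Proof.
pose M (A : G) := odflt 0 [pick M : 'M[F]_n | K A == vecs M].
have ME A : K A = vecs (M A).
  rewrite /M; case: pickP => [N /eqP//|no].
  by have [N KN] := K_space A; have := no N; rewrite KN eqxx.
have [x kx] := ka_onto (\bigcap_(A in X) M A)%MS; exists x.
rewrite tcl_label; apply/setP=> B; rewrite !inE kx; have [N kB] := ka_space B.
rewrite kB vecsS; apply/forall_inP/sub_bigcapmxP => h A AX.
  by have := h A AX; rewrite edgeE kB ME vecsS.
by rewrite edgeE kB ME vecsS h.
Qed.

End SubspaceLabels.

(** Multiply a transposed row base of B by a row base of A: both factors have full rank, so neither
    row space changes. *)
Lemma rank_factorization (F : finFieldType) n k (A B : 'M[F]_n) :
  \rank A = k -> \rank B = k ->
  exists C : 'M[F]_n, (C :=: A)%MS /\ (C^T :=: B)%MS.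
Proof.
move=> <- rB; have eAB : \rank B = \rank A by [].
pose A' := row_base A.
have [B' B'B fB] : exists2 B' : 'M[F]_(\rank A, n), (B' :=: B)%MS & row_free B'.
  by rewrite -eAB; exists (row_base B); [apply: eq_row_base|apply: row_base_free].
have fA : row_free A' by apply: row_base_free.
exists (B'^T *m A'); split.
  apply: eqmx_trans (eq_row_base A); apply: eqmxMfull.
  by rewrite /row_full mxrank_tr; exact: fB.
rewrite trmx_mul trmxK; apply: eqmx_trans B'B.
by apply: eqmxMfull; rewrite /row_full mxrank_tr.
Qed.

Section ThetaLevels.

Variables (F : finFieldType) (m : nat).
Local Notation n := m.+1.
Local Notation Th := (Theta 'M[F]_n).
Implicit Types (A B : Th) (a b : 'M[F]_n).

(** Matrices with the same row space differ by a unit on the left, and those with the same column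
    space by a unit on the right. *)
Lemma assoc_vecs a b : assoc a b = (vecs a == vecs b) && (vecs a^T == vecs b^T).
Proof.
apply/assocP/andP => [[u [v [uu vu au av]]]|[/vecs_eqmx e1 /vecs_eqmx e2]].
  split; apply/vecs_eqmx/eqmxP/eqmxMunitP; first by exists v.
  exists u^T; first by rewrite unitmx_tr.
  by rewrite -trmx_mul [in LHS]au.
have /eqmxMunitP[v vu av] : (a == b)%MS by apply/eqmxP.
have /eqmxMunitP[u uu au] : (a^T == b^T)%MS by apply/eqmxP.
exists u^T, v; split=> //; first by rewrite unitmx_tr in uu *.
by apply: trmx_inj; rewrite [RHS]trmx_mul trmxK.
Qed.

Lemma rep_ex A : exists a, A == assoc_class a.
Proof. by have [a ->] := assoc_class_surj A; exists a. Qed.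

Definition rep A : 'M[F]_n := xchoose (rep_ex A).

Lemma repK A : assoc_class (rep A) = A.
Proof. by apply/esym/eqP/(xchooseP (rep_ex A)). Qed.

(** Column spaces and right kernels are transposed so that all four labels are sets of row
    vectors. *)
Definition Trow A := vecs (rep A).
Definition Tcol A := vecs (rep A)^T.
Definition Tlker A := vecs (kermx (rep A)).
Definition Trker A := vecs (kermx (rep A)^T).
Definition Trank A := \rank (rep A).

Lemma assoc_rep a : assoc (rep (assoc_class a)) a.
Proof. by rewrite -assoc_class_eq repK. Qed.

Lemma Trow_class a : Trow (assoc_class a) = vecs a.
Proof. by have := assoc_rep a; rewrite assoc_vecs => /andP[/eqP]. Qed.

Lemma Tcol_class a : Tcol (assoc_class a) = vecs a^T.
Proof. by have := assoc_rep a; rewrite assoc_vecs => /andP[_ /eqP]. Qed.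

Lemma kermx_col_eq a b : vecs a^T = vecs b^T -> vecs (kermx a) = vecs (kermx b).
Proof.
move/eqP/vecs_eqmx=> /eqmxP/eqmxMunitP[u uu e].
have e' : a = b *m u^T by apply: trmx_inj; rewrite trmx_mul trmxK.
apply/setP=> v; rewrite !inE; apply/sub_kermxP/sub_kermxP => h.
  apply: (can_inj (mulmxK (_ : u^T \in unitmx))); first by rewrite unitmx_tr.
  by rewrite mul0mx -mulmxA -e'.
by rewrite e' mulmxA h mul0mx.
Qed.

Lemma Trker_class a : Trker (assoc_class a) = vecs (kermx a^T).
Proof. by apply: kermx_col_eq; rewrite !trmxK; apply: Trow_class. Qed.

Lemma Tlker_class a : Tlker (assoc_class a) = vecs (kermx a).
Proof. by apply: kermx_col_eq; apply: Tcol_class. Qed.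

Lemma edge_col A B : edge A B = (Tcol B \subset Trker A).
Proof.
rewrite -{1}(repK A) -{1}(repK B) Theta_edgeE vecsS.
apply/eqP/sub_kermxP => [e|e]; first by rewrite -trmx_mul [_ *m _]e trmx0.
by apply: trmx_inj; rewrite [LHS]trmx_mul e trmx0.
Qed.

Lemma edge_row A B : edge A B = (Trow A \subset Tlker B).
Proof.
rewrite -{1}(repK A) -{1}(repK B) Theta_edgeE vecsS.
by apply/eqP/sub_kermxP.
Qed.

Lemma Trow_Gr A : Trow A \in Gr F n (Trank A).
Proof. exact: vecs_Gr. Qed.

Lemma Tcol_Gr A : Tcol A \in Gr F n (Trank A).
Proof. by rewrite /Trank -mxrank_tr; apply: vecs_Gr. Qed.

Lemma Tlabels_inj A B : Trow A = Trow B -> Tcol A = Tcol B -> A = B.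
Proof.
move=> e1 e2; rewrite -(repK A) -(repK B); apply/eqP.
by rewrite assoc_class_eq assoc_vecs -/(Trow A) e1 -/(Tcol A) e2 !eqxx.
Qed.

Lemma Tlabels_ex k U W : U \in Gr F n k -> W \in Gr F n k ->
  exists A, Trow A = U /\ Tcol A = W.
Proof.
move=> /GrP[a ra ->] /GrP[b rb ->]; have [c [ca cb]] := rank_factorization ra rb.
exists (assoc_class c); rewrite Trow_class Tcol_class.
by split; apply/eqP/vecs_eqmx.
Qed.

Lemma card_Tlabels k (X Y : {set {set 'rV[F]_n}}) : X \subset Gr F n k -> Y \subset Gr F n k ->
  #|[set A | (Trow A \in X) && (Tcol A \in Y)]| = (#|X| * #|Y|)%N.
Proof.
move=> XG YG; rewrite -cardsX.
have inj : injective (fun A => (Trow A, Tcol A)).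
  by move=> A B [e1 e2]; apply: Tlabels_inj.
rewrite -(card_imset _ inj); apply: eq_card => -[U W]; rewrite in_setX /=.
apply/imsetP/andP => [[A]|[UX WY]]; first by rewrite inE => /andP[AX AY] [-> ->].
have [A [AU AW]] := Tlabels_ex (subsetP XG U UX) (subsetP YG W WY).
by exists A; rewrite ?inE AU AW ?UX.
Qed.

Lemma Tcol_onto a : exists A, Tcol A = vecs a.
Proof. by exists (assoc_class a^T); rewrite Tcol_class trmxK. Qed.

Lemma Trow_onto a : exists A, Trow A = vecs a.
Proof. by exists (assoc_class a); rewrite Trow_class. Qed.

Lemma kermx_onto a : exists b, vecs (kermx b) = vecs a.
Proof.
exists (cokermx a); apply/setP=> v; rewrite !inE [in RHS]submxE.
exact/sub_kermxP/eqP.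
Qed.

Lemma Trker_onto a : exists A, Trker A = vecs a.
Proof.
have [b <-] := kermx_onto a.
by exists (assoc_class b^T); rewrite Trker_class trmxK.
Qed.

Lemma Tlker_onto a : exists A, Tlker A = vecs a.
Proof.
have [b <-] := kermx_onto a.
by exists (assoc_class b); rewrite Tlker_class.
Qed.

Lemma rank_lker A : \rank (kermx (rep A)) = (n - Trank A)%N.
Proof. by rewrite mxrank_ker. Qed.

Lemma rank_rker A : \rank (kermx (rep A)^T) = (n - Trank A)%N.
Proof. by rewrite mxrank_ker mxrank_tr. Qed.

Lemma Trank_Trow A k : (Trank A == k) = (Trow A \in Gr F n k).
Proof.
apply/eqP/idP => [<-|]; [exact: Trow_Gr|exact: Gr_uniq (Trow_Gr A)].
Qed.

Lemma Trank_Tcol A k : (Trank A == k) = (Tcol A \in Gr F n k).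
Proof.
apply/eqP/idP => [<-|]; [exact: Tcol_Gr|exact: Gr_uniq (Tcol_Gr A)].
Qed.

Theorem Theta_levelled : levelled F n Trank.
Proof.
have subG k (W : {set 'rV[F]_n}) : [set U in Gr F n k | U \subset W] \subset Gr F n k.
  by apply/subsetP=> U; rewrite inE => /andP[].
have col_sp A : exists M : 'M[F]_n, Tcol A = vecs M by exists (rep A)^T.
have row_sp A : exists M : 'M[F]_n, Trow A = vecs M by exists (rep A).
have rk_sp A : exists M : 'M[F]_n, Trker A = vecs M by eexists.
have lk_sp A : exists M : 'M[F]_n, Tlker A = vecs M by eexists.
have edge_rev (A B : rev_digraph Th) : edge A B = (Trow B \subset Tlker A).
  exact: edge_row.
have tE := tcl_label edge_col Trker_onto col_sp.
have sE := tcl_label edge_rev Tlker_onto row_sp.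
split.
- by move=> A; apply: rank_leq_row.
- move=> k _; rewrite -mulnn -card_Gr -(card_Tlabels (subxx _) (subxx _)).
  by apply: eq_card => A; rewrite !inE -Trank_Trow -Trank_Tcol andbb.
(* An out-neighbour of rank j has an arbitrary row space and a column space inside the right kernel,
   of dimension n - k for [A] of rank k; for in-neighbours the roles are exchanged. *)
- move=> j A _; split.
    rewrite -rank_rker -(card_Gr_sub _ (kermx (rep A)^T)) -card_Gr.
    rewrite -(card_Tlabels (subxx _) (subG j _)); apply: eq_card => B.
    rewrite in_setI in_out1 edge_col !inE -Trank_Trow -Trank_Tcol.
    by case: eqP; rewrite ?andbF ?andbT.
  rewrite mulnC -rank_lker -(card_Gr_sub _ (kermx (rep A))) -card_Gr.
  rewrite -(card_Tlabels (subG j _) (subxx _)); apply: eq_card => B.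
  rewrite in_setI in_in1 edge_row !inE -Trank_Trow -Trank_Tcol.
  by case: eqP; rewrite ?andbF ?andbT.
- split=> X; first exact: (out_label edge_col rk_sp Tcol_onto Trker_onto col_sp).
  exact: (@out_label _ _ (rev_digraph Th) _ _ edge_rev lk_sp Trow_onto Tlker_onto row_sp).
(* At equal rank the inclusions are equalities, so the only vertex is the class with the row space
   of [B] and the column space of [A]. *)
move=> A B AB; apply/eqP/cards1P.
have TB : Trow B \in Gr F n (Trank A) by rewrite AB Trow_Gr.
have [C [Crow Ccol]] := Tlabels_ex TB (Tcol_Gr A).
exists C; apply/setP=> E; rewrite inE in_setI in_setI tE.
have -> : source_closure [set B] = [set E | Trow E \subset Trow B] by exact: sE.
rewrite !inE; apply/andP/eqP => [[/andP[cE rE] /eqP lE]|->].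
  have rG : Trow E \in Gr F n (Trank A) by rewrite -lE Trow_Gr.
  have cG : Tcol E \in Gr F n (Trank A) by rewrite -lE Tcol_Gr.
  apply: Tlabels_inj; first by rewrite Crow (Gr_sub_eq rG TB rE).
  by rewrite Ccol (Gr_sub_eq cG (Tcol_Gr A) cE).
by rewrite Crow Ccol !subxx Trank_Tcol Ccol Tcol_Gr.
Qed.

End ThetaLevels.

End MatrixRing.

Lemma digraph_iso_sym (G H : digraph) : digraph_iso G H -> digraph_iso H G.
Proof.
case=> f [g fK gK] fE; exists g; first by exists f.
by move=> u v; rewrite -fE !gK.
Qed.

Lemma digraph_iso_trans (G H K : digraph) :
  digraph_iso G H -> digraph_iso H K -> digraph_iso G K.
Proof.
case=> f fb fE [g gb gE]; exists (g \o f); first exact: bij_comp.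
by move=> u v; rewrite /= gE fE.
Qed.

Theorem theorem4p2 (n q : nat) (F : finFieldType)
    (n_gt0 : (0 < n)%N) (n_neq3 : n <> 3)
    (q_gt1 : (1 < q)%N) (q_pp : exists p m : nat, prime p /\ q = (p ^ m)%N)
    (cardF : #|F| = q) :
  exists G : digraph,
    [/\ five_properties n F G,
        (forall H : digraph, five_properties n F H -> digraph_iso G H)
      & digraph_iso G (Theta 'M[F]_(n.-1.+1))].
Proof.
case: n n_gt0 n_neq3 => // m n_gt0 n_neq3.
have LV := Theta_levelled F m.
exists (Theta 'M[F]_m.+1); split.
- exact: levelled_five LV.
- move=> H /five_levelled[lv LVH].
  apply: (digraph_iso_trans (levelled_iso n_gt0 n_neq3 LV)).
  exact: digraph_iso_sym (levelled_iso n_gt0 n_neq3 LVH).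
by exists id; first by exists id.
Qed.
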